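(* There is an absolute constant $c$ such that the following holds for all integers $d\ge 2$ and $n,r\ge 1$. Let $G_n$ be a random $2d$-regular graph on $n$ vertices from the permutation model, and let $\mathcal I=\bigcup_{k=1}^r\mathcal I_k$, where $\mathcal I_k$ is the set of all labeled $k$-cycles on $\{1,\dots,n\}$. For $\alpha\in\mathcal I$ let $I_\alpha=1\{G_n\text{ contains }\alpha\}$ and let $\mathbf I=(I_\alpha,\ \alpha\in\mathcal I)$. Let $\mathbf Z=(Z_\alpha,\ \alpha\in\mathcal I)$ be a vector whose coordinates are independent Poisson random variables with $\mathbf E Z_\alpha=1/[n]_k$ for $\alpha\in\mathcal I_k$. Then $$d_{TV}(\mathbf I,\mathbf Z)\le \frac{c(2d-1)^{2r-1}}{n}.$$
   Context: Notation: $[n]_k=n(n-1)\cdots(n-k+1)$; $d_{TV}(X,Y)$ is the total variation distance between the laws of $X$ and $Y$ (supremum over measurable sets of the difference of probabilities). Permutation model: let $\pi_1,\dots,\pi_d$ be independent uniformly random permutations of $\{1,\dots,n\}$. $G_n$ is the multigraph on $\{1,\dots,n\}$ having, for each $l$ and each $i$, an edge between $i$ and $\pi_l(i)$, regarded as directed from $i$ to $\pi_l(i)$ and labeled $\pi_l$. Loops and multiple edges are allowed; a loop counts twice in the degree. Words: a word $w=w_1\cdots w_k$ in the letters $\pi_1^{\pm1},\dots,\pi_d^{\pm1}$ is cyclically reduced if $w_i\ne w_{i+1}^{-1}$ for all $i$, indices modulo $k$. Labeled $k$-cycles: consider pairs consisting of a sequence of distinct vertices $s_0,\dots,s_{k-1}\in\{1,\dots,n\}$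 (with $s_k=s_0$) and a cyclically reduced word $w_1\cdots w_k$, where $w_i$ is the label of the step from $s_{i-1}$ to $s_i$ (a letter $\pi_l$ means the $\pi_l$-labeled edge is followed forwards, $\pi_l^{-1}$ means it is followed backwards). A labeled $k$-cycle is an equivalence class of such pairs, where two are identified if they differ only by the choice of starting vertex and direction of traversal. $G_n$ contains the cycle if $w_i(s_{i-1})=s_i$ for all $1\le i\le k$, with $w_i$ viewed as a permutation. *)

(* Defs.v *)
From HB Require Import structures.
From mathcomp Require Import all_boot all_order all_algebra all_fingroup.
From mathcomp Require Import zify.
From mathcomp Require Import all_classical all_reals all_analysis.

Set Implicit Arguments.
Unset Strict Implicit.
Unset Printing Implicit Defensive.

Import Order.TTheory GRing.Theory Num.Theory.

Local Open Scope classical_set_scope.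

(* A finite permutation group carries the discrete sigma-algebra, so that a
   random permutation is an ordinary random variable. *)
Section PermMeasurable.
Variable T : finType.
HB.instance Definition _ := isPointed.Build (perm_type T) 1%g.
HB.instance Definition _ := @isMeasurable.Build default_measure_display
  (perm_type T) discrete_measurable discrete_measurable0
  discrete_measurableC discrete_measurableU.
End PermMeasurable.

(* Finite families of points of T carry the product sigma-algebra, generated
   by the coordinate maps. *)
Definition ffun_display : measure_display -> measure_display.
Proof. exact. Qed.

Section FfunMeasurable.
Variables (I : finType) (d : measure_display) (T : measurableType d).

HB.instance Definition _ := isPointed.Build {ffun I -> T} [ffun=> point].

Definition ffun_measurable : set (set {ffun I -> T}) :=
  <<s \bigcup_(i in [set: I])
        preimage_set_system setT (fun f : {ffun I -> T} => f i) measurable >>.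

Let ffun_measurable0 : ffun_measurable set0.
Proof. exact: sigma_algebra0. Qed.

Let ffun_measurableC A : ffun_measurable A -> ffun_measurable (~` A).
Proof. exact: sigma_algebraC. Qed.

Let ffun_measurableU (F : (set {ffun I -> T})^nat) :
  (forall i, ffun_measurable (F i)) -> ffun_measurable (\bigcup_i F i).
Proof. exact: sigma_algebra_bigcup. Qed.

HB.instance Definition _ := @isMeasurable.Build (ffun_display d)
  {ffun I -> T} ffun_measurable ffun_measurable0
  ffun_measurableC ffun_measurableU.
End FfunMeasurable.

Section Probability.
Local Open Scope ereal_scope.
Variables (R : realType) (d : measure_display) (T : measurableType d).

Definition dTV (mu nu : set T -> \bar R) : \bar R :=
  ereal_sup [set `|mu A - nu A| | A in measurable].

Definition mutually_independent (d' : measure_display)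
    (T' : measurableType d') (P : probability T R) (I : finType)
    (X : I -> {RV P >-> T'}) : Prop :=
  forall (J : {set I}) (A : I -> set T'),
    (forall i, measurable (A i)) ->
    P (\bigcap_(i in [set` J]) (X i @^-1` A i)) =
    \prod_(i in J) P (X i @^-1` A i).

Definition uniform_perm (n : nat) (P : probability T R)
    (X : {RV P >-> {perm 'I_n}}) : Prop :=
  forall g, P (X @^-1` [set g]) = (n`!%:R^-1)%:E.

(* [poisson_pmf] is the usual mass function only for a positive rate. *)
Definition poisson_rv (P : probability T R) (rate : R)
    (X : {RV P >-> nat}) : Prop :=
  forall j, P (X @^-1` [set j]) = (poisson_pmf rate j)%:E.
End Probability.

(* The vertices are 0, ..., n - 1.  A d-tuple of permutations is identified
   with the multigraph having an edge labelled l from i to pi l i for all l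
   and i. *)
Definition perm_graph (d n : nat) := 'I_d -> {perm 'I_n}.

(* (l, false) stands for pi_l and (l, true) for its inverse. *)
Definition letter (d : nat) : finType := ('I_d * bool)%type.

Definition letter_inv d (a : letter d) : letter d := (a.1, ~~ a.2).

Definition letter_perm d n (pi : perm_graph d n) (a : letter d) : {perm 'I_n} :=
  if a.2 then (pi a.1)^-1%g else pi a.1.

(* Vertices s_0, ..., s_{k-1}, and letters numbered from 0: the i-th letter
   labels the step from s_i to s_{i+1}, where i + 1 is [ordS i], i.e. taken
   modulo k. *)
Definition walk (d n k : nat) : finType :=
  ({ffun 'I_k -> 'I_n} * {ffun 'I_k -> letter d})%type.

Section Walks.
Variables d n k : nat.
Implicit Types p q : walk d n k.

Definition cyclically_reduced (w : {ffun 'I_k -> letter d}) : bool :=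
  [forall i, w i != letter_inv (w (ordS i))].

Definition is_cycle p : bool := injectiveb p.1 && cyclically_reduced p.2.

Definition rotate p : walk d n k :=
  ([ffun i => p.1 (ordS i)], [ffun i => p.2 (ordS i)]).

(* Vertices s_0, s_{k-1}, ..., s_1; the step from s_{i+1} to s_i carries the
   inverse of the letter of the step from s_i to s_{i+1}. *)
Definition reverse p : walk d n k :=
  ([ffun i => p.1 (ordS (rev_ord i))],
   [ffun i => letter_inv (p.2 (rev_ord i))]).

Definition same_cycle p q : bool :=
  [exists m : 'I_k,
     (q == iter m rotate p) || (q == iter m rotate (reverse p))].

Definition labeled_cycles : {set {set walk d n k}} :=
  equivalence_partition same_cycle [set p | is_cycle p]%SET.

Definition labeled_cycle : finType :=
  {alpha : {set walk d n k} | alpha \in labeled_cycles}.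

Definition follows (pi : perm_graph d n) p : bool :=
  [forall i, letter_perm pi (p.2 i) (p.1 i) == p.1 (ordS i)].

(* All representatives agree, see [follows_same_cycle]. *)
Definition contains (pi : perm_graph d n) (alpha : labeled_cycle) : bool :=
  [exists p in val alpha, follows pi p].

End Walks.

(* The union of the sets of labeled k-cycles over 1 <= k <= r, the first
   component being k - 1. *)
Definition cycle_upto (d n r : nat) : finType :=
  {k : 'I_r & labeled_cycle d n k.+1}.

Definition cycle_length d n r (alpha : cycle_upto d n r) : nat :=
  (tag alpha).+1.

Definition cycle_indicators d n r (pi : perm_graph d n) :
    {ffun cycle_upto d n r -> nat} :=
  [ffun alpha => nat_of_bool (contains pi (tagged alpha))].

Section SameCycle.
Variables d n k : nat.
Implicit Types p q : walk d n k.

Lemma letter_invK : involutive (@letter_inv d).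
Proof. by case=> l b; rewrite /letter_inv /= negbK. Qed.

Lemma letter_perm_inv (pi : perm_graph d n) a :
  letter_perm pi (letter_inv a) = (letter_perm pi a)^-1%g.
Proof. by case: a => l [] //; rewrite /letter_perm /= invgK. Qed.

Lemma rev_ordS (i : 'I_k) : rev_ord (ordS i) = ord_pred (rev_ord i).
Proof.
apply: val_inj => /=; case: i => i /= ik.
have [ik1|ik1] := ltnP i.+1 k; last first.
  have -> : k = i.+1 by apply/eqP; rewrite eqn_leq ik ik1.
  by rewrite modnn subSS subn0 subnn add0n /= modn_small.
rewrite modn_small // [RHS](_ : _ = (k - i.+2 + k) %% k)%N; last by congr modn; lia.
by rewrite modnDr modn_small //; lia.
Qed.

Lemma follows_rotate pi p : follows pi (rotate p) = follows pi p.
Proof.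
apply/forallP/forallP => h i; last by rewrite !ffunE.
by have := h (ord_pred i); rewrite !ffunE ord_predK.
Qed.

Lemma reverseK : involutive (@reverse d n k).
Proof.
move=> [s w]; congr pair; apply/ffunP => i; rewrite !ffunE /=.
  by rewrite rev_ordS rev_ordK ord_predK.
by rewrite rev_ordK letter_invK.
Qed.

Lemma reverse_rotate p : rotate (reverse (rotate p)) = reverse p.
Proof.
by congr pair; apply/ffunP => i; rewrite !ffunE /= rev_ordS ord_predK.
Qed.

Lemma follows_reverse pi p : follows pi (reverse p) = follows pi p.
Proof.
have fr q : follows pi q -> follows pi (reverse q).
  move=> /forallP h; apply/forallP => i; rewrite !ffunE letter_perm_inv.
  by rewrite rev_ordS ord_predK -(eqP (h (rev_ord i))) permK.
by apply/idP/idP => /fr //; rewrite reverseK.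
Qed.

Lemma follows_same_cycle pi p q :
  same_cycle p q -> follows pi p = follows pi q.
Proof.
have fi m x : follows pi (iter m (@rotate d n k) x) = follows pi x.
  by elim: m => //= m <-; exact: follows_rotate.
by case/existsP=> m /orP[] /eqP ->; rewrite fi ?follows_reverse.
Qed.

Lemma iter_ordS m (i : 'I_k) : iter m (@ordS k) i = (i + m) %% k :> nat.
Proof.
elim: m => [|m IH]; first by rewrite addn0 modn_small.
by rewrite iterS /= IH -addn1 modnDml addn1 addnS.
Qed.

Lemma iter_rotate m p : iter m (@rotate d n k) p =
  ([ffun i => p.1 (iter m (@ordS k) i)], [ffun i => p.2 (iter m (@ordS k) i)]).
Proof.
elim: m => [|m IH]; last first.
  by rewrite iterS IH; congr pair; apply/ffunP => i; rewrite !ffunE -iterSr.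
by case: p => s w; congr pair; apply/ffunP => i; rewrite ffunE.
Qed.

Lemma iter_rotate_mod m p :
  iter m (@rotate d n k) p = iter (m %% k) (@rotate d n k) p.
Proof.
rewrite !iter_rotate; congr pair; apply/ffunP => i; rewrite !ffunE;
  by congr (_ _); apply: val_inj; rewrite /= !iter_ordS modnDmr.
Qed.

Lemma same_cycleP p q : (0 < k)%N ->
  reflect (exists m, q = iter m (@rotate d n k) p \/
                     q = iter m (@rotate d n k) (reverse p))
          (same_cycle p q).
Proof.
move=> k0; apply: (iffP existsP) => [[m /orP[]/eqP->]|[m]].
- by exists m; left.
- by exists m; right.
rewrite iter_rotate_mod (iter_rotate_mod m (reverse p)) => h.
exists (Ordinal (ltn_pmod m k0)) => /=.
by case: h => ->; rewrite eqxx ?orbT.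
Qed.

Lemma reverse_iter m p :
  iter m (@rotate d n k) (reverse (iter m (@rotate d n k) p)) = reverse p.
Proof. by elim: m p => // m IH p; rewrite iterSr iterS reverse_rotate IH. Qed.

Lemma iter_rotateK m p : (0 < k)%N ->
  iter (k * m - m) (@rotate d n k) (iter m (@rotate d n k) p) = p.
Proof.
move=> k0; rewrite -iterD subnK ?leq_pmull // iter_rotate_mod.
by rewrite modnMr.
Qed.

Lemma reverse_iterE m p : (0 < k)%N ->
  reverse (iter m (@rotate d n k) p) =
  iter (k * m - m) (@rotate d n k) (reverse p).
Proof. by move=> k0; rewrite -(reverse_iter m p) iter_rotateK. Qed.

Lemma same_cycle_equiv : (0 < k)%N -> equivalence_rel (@same_cycle d n k).
Proof.
move=> k0.
have sym p q : same_cycle p q -> same_cycle q p.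
  case/(same_cycleP _ _ k0) => m [->|->]; apply/(same_cycleP _ _ k0).
    by exists (k * m - m)%N; left; rewrite iter_rotateK.
  by exists m; right; rewrite reverse_iter reverseK.
have tr p q t : same_cycle p q -> same_cycle q t -> same_cycle p t.
  case/(same_cycleP _ _ k0) => m hm; case/(same_cycleP _ _ k0) => l hl.
  apply/(same_cycleP _ _ k0).
  case: hm hl => -> [] ->; rewrite ?reverse_iterE // ?reverseK -?iterD;
    eexists; ((by left; reflexivity) || (by right; reflexivity)).
move=> p q t; split; first by apply/(same_cycleP _ _ k0); exists 0%N; left.
by move=> pq; apply/idP/idP; apply: tr => //; exact: sym.
Qed.

End SameCycle.

(* Main.v *)
Require Import Defs.
From mathcomp Require Import all_boot all_order all_algebra all_fingroup.
From mathcomp Require Import ring lra zify.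
From mathcomp Require Import all_classical all_reals all_analysis.

Set Implicit Arguments.
Unset Strict Implicit.
Unset Printing Implicit Defensive.

Import Order.TTheory GRing.Theory Num.Theory.

Local Open Scope ring_scope.

(** Write [b = 2 d - 1].  There are finitely many cycles and the permutations are
    uniform on a finite set, so the theorem compares finite averages.  Replace
    the indicators of the cycles one at a time by independent Poisson
    variables.  Replacing the indicator of a cycle [alpha], of probability [p]
    and rate [l = 1 / [n]_k], costs at most a constant times [p] times the
    distance between the law of the other indicators and their conditional law
    given [alpha], plus [l - p] for the wrong rate and [l ^ 2] for the Poisson
    values above 1 (lemma [lindeberg]).  The last two are easily summed, since
    [1 / n ^ k <= p <= 1 / [n]_k].

    The conditional law has an explicit coupling: force the edges of [alpha] into
    the permutations one after the other, each time by composing with a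
    transposition ([couple], [mean_couple]).  So the main cost is [p] times the
    expected number of cycles [beta] other than [alpha] that are present in only
    one of the two graphs.  There are three kinds, for [alpha] of length [k] and
    [beta] of length [j].
    - [beta] is in the original graph and shares a tail or a head with an edge of
      the same label of [alpha].  It may be taken to start along one of [2 k]
      darts, and then has at most [b ^ (j - 1)] words.
    - [beta] is in the coupled graph and shares an edge with [alpha].  Since it is
      not [alpha], it has an edge outside [alpha] ([cycle_eq]), and it may be
      taken to start along an edge of [alpha] and to end with an edge outside
      [alpha]; again [2 k b ^ (j - 1)] choices.
    - Otherwise the coupling can only create [beta] ([couple_keep]), with
      probability the difference between the conditional and the unconditional
      probability of [beta]; this is at most the conditional probability times
      the number of pairs of edges of equal label in [alpha] and [beta], divided
      by [n - r] ([Pr_edges_cat_le]).  Rotating [beta] to start along the edge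
      of the pair leaves [2 n k] darts and [b ^ (j - 1)] words.
    In each case the starting dart and the word determine [beta] inside a given
    graph, and the closing edge hits its end point with probability of order
    [1 / n] ([explore], [class_bound]).  The three expectations are therefore of
    order [k b ^ (j - 1) / n].

    By the same exploration, the sum of [k p] over the cycles of length [k] is of
    order [b ^ k].  The total is of order the sum of [b ^ k b ^ (j - 1) / n] over
    [j, k <= r], that is, [b ^ (2 r - 1) / n].  This uses that [n] is large compared
    with [r]; if not, [b ^ (2 r - 1) / n] is bounded below and there is nothing to
    prove. *)

(** * Averages over a finite set *)

Section Mean.
Variables (R : realFieldType) (T : finType).
Implicit Types F G : T -> R.

Definition mean F : R := (\sum_t F t) / #|T|%:R.

Lemma eq_mean F G : F =1 G -> mean F = mean G.
Proof. by move=> FG; rewrite /mean (eq_bigr G). Qed.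

Lemma meanD F G : mean (fun t => F t + G t) = mean F + mean G.
Proof. by rewrite /mean big_split mulrDl. Qed.

Lemma meanZ c F : mean (fun t => c * F t) = c * mean F.
Proof. by rewrite /mean -mulr_sumr mulrA. Qed.

Lemma meanB F G : mean (fun t => F t - G t) = mean F - mean G.
Proof. by rewrite /mean big_split/= sumrN mulrBl. Qed.

Lemma mean_sum (J : finType) (P : pred J) (F : J -> T -> R) :
  mean (fun t => \sum_(j | P j) F j t) = \sum_(j | P j) mean (F j).
Proof. by rewrite /mean exchange_big/= mulr_suml. Qed.

Lemma le_mean F G : (forall t, F t <= G t) -> mean F <= mean G.
Proof. by move=> FG; rewrite /mean ler_wpM2r ?invr_ge0 ?ler0n// ler_sum. Qed.

Lemma mean_ge0 F : (forall t, 0 <= F t) -> 0 <= mean F.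
Proof. by move=> F0; rewrite /mean mulr_ge0 ?invr_ge0 ?ler0n// sumr_ge0. Qed.

Lemma ler_norm_mean F : `|mean F| <= mean (fun t => `|F t|).
Proof.
rewrite /mean normrM [X in _ * X]ger0_norm ?invr_ge0//.
by rewrite ler_wpM2r ?invr_ge0// ler_norm_sum.
Qed.

Lemma mean_cst c : (0 < #|T|)%N -> mean (fun=> c) = c.
Proof.
by move=> T0; rewrite /mean sumr_const -(mulr_natr c) mulfK// pnatr_eq0 -lt0n.
Qed.

End Mean.

(** * Replacing dependent bits by independent ones *)

Section Lindeberg.
Variables (R : realFieldType) (T I : finType).
Implicit Types (x : {ffun I -> bool}) (f g : {ffun I -> bool} -> R).

Definition set_coord x (a : I) (b : bool) : {ffun I -> bool} :=
  [ffun i => if i == a then b else x i].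

(** The two weights may add up to less than 1: a Poisson variable takes other
    values than 0 and 1. *)
Definition resample (q : I -> bool -> R) a g x : R :=
  q a false * g (set_coord x a false) + q a true * g (set_coord x a true).

Lemma resample_bound q a g : (forall i b, 0 <= q i b) ->
  q a false + q a true <= 1 ->
  (forall x, `|g x| <= 1) -> forall x, `|resample q a g x| <= 1.
Proof.
move=> q0 q1 g1 x; rewrite /resample (le_trans (ler_normD _ _))//.
rewrite !normrM !(ger0_norm (q0 _ _)); apply: le_trans q1.
by rewrite lerD// ler_piMr.
Qed.

(** Resampling every coordinate forgets the starting point [x], which is how the
    product weights appear at the end of the replacement. *)
Lemma foldr_resampleE q s f x : uniq s ->
  foldr (resample q) f s x =
  \sum_y f y * \prod_i if i \in s then q i (y i) else (x i == y i)%:R.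
Proof.
elim: s x => [|a s IH] x /=.
  move=> _; rewrite (bigD1 x)//= big1 ?mulr1 => [|i _]; last by rewrite eqxx.
  rewrite big1 ?addr0// => y yx; suff [i xi] : exists i, x i != y i.
    by rewrite (bigD1 i)//= (negbTE xi) mul0r mulr0.
  apply/existsP; rewrite -negb_forall; apply: contra yx => /forallP xy.
  by apply/eqP/ffunP => i; rewrite (eqP (xy i)).
case/andP => as_ us; rewrite /resample !IH// !mulr_sumr -big_split/=.
apply: eq_bigr => y _; rewrite !(bigD1 (P := predT) a)//= inE eqxx (negbTE as_)/=.
have E b : \prod_(i | i != a)
    (if i \in s then q i (y i) else (set_coord x a b i == y i)%:R) =
    \prod_(i | i != a) (if i \in a :: s then q i (y i) else (x i == y i)%:R) :> R.
  apply: eq_bigr => i ia; rewrite inE (negbTE ia)/= ffunE (negbTE ia)//.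
rewrite !E !ffunE eqxx; set Q := \prod_(_ | _) _.
case: (y a) => /=; ring.
Qed.

(** The coordinates are replaced one at a time, so that only one replacement
    has to be understood.  Resampling the bit [a] of [W] would change nothing if
    [W a] were independent of the other bits; the error is thus governed by how
    much conditioning on [W a = 1] moves the other bits, and [C a], which
    realizes this conditional law on the same space, bounds it by the number of
    bits that it changes.  The last two terms account for weights [q a] that are
    not exactly the law of [W a]. *)
Lemma lindeberg (W : T -> {ffun I -> bool}) (C : I -> T -> T)
    (p : I -> R) (q : I -> bool -> R) f :
  (0 < #|T|)%N ->
  (forall a F, mean (fun t => (W t a)%:R * F t) = p a * mean (F \o C a)) ->
  (forall a, 0 <= p a) ->
  (forall a b, 0 <= q a b) -> (forall a, q a false + q a true <= 1) ->
  (forall x, `|f x| <= 1) ->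
  `|mean (f \o W) - \sum_x f x * \prod_a q a (x a)| <=
  \sum_a (4 * (p a * \sum_(b | b != a) mean (fun t => (W (C a t) b != W t b)%:R))
          + `|p a - q a true| + `|1 - p a - q a false|).
Proof.
move=> T0 couple p0 q0 q1 f1.
pose err a := 4 * (p a * \sum_(b | b != a) mean (fun t => (W (C a t) b != W t b)%:R))
          + `|p a - q a true| + `|1 - p a - q a false|.
have step a g : (forall x, `|g x| <= 1) ->
    `|mean (g \o W) - mean (resample q a g \o W)| <= err a.
  move=> g1.
  (* The bit [a] of [W] enters [g (W t)] only through the choice between [gb true]
     and [gb false], and these two depend on the other bits alone. *)
  pose gb b t := g (set_coord (W t) a b).
  have gb1 b : `|mean (gb b)| <= 1.
    rewrite (le_trans (ler_norm_mean _))// -[leRHS](@mean_cst R T 1)//.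
    by apply: le_mean => t; exact: g1.
  pose D b := mean (fun t => gb b (C a t)) - mean (gb b).
  have Db b : `|D b| <= 2 * \sum_(b | b != a) mean (fun t => (W (C a t) b != W t b)%:R).
    rewrite /D -meanB (le_trans (ler_norm_mean _))//.
    rewrite -mean_sum -meanZ; apply: le_mean => t.
    have [/existsP[i /andP[ia Wi]]|] :=
      boolP [exists i, (i != a) && (W (C a t) i != W t i)]; last first.
      rewrite negb_exists => /forallP WW.
      rewrite /gb (_ : set_coord (W (C a t)) _ _ = set_coord (W t) a b).
        by rewrite subrr normr0 mulr_ge0// sumr_ge0.
      apply/ffunP => i; rewrite !ffunE; case: eqVneq => // ia.
      by have := WW i; rewrite ia/= negbK => /eqP.
    rewrite (bigD1 i)//= Wi/= mulrDr mulr1 (le_trans (ler_normB _ _))//.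
    have := g1 (set_coord (W (C a t)) a b); have := g1 (set_coord (W t) a b).
    have : 0 <= \sum_(i0 | (i0 != a) && (i0 != i)) (W (C a t) i0 != W t i0)%:R :> R.
      exact: sumr_ge0.
    rewrite /gb; lra.
  have -> : mean (g \o W) - mean (resample q a g \o W) =
    (p a * D true) - (p a * D false) + (p a - q a true) * mean (gb true)
    + (1 - p a - q a false) * mean (gb false).
    rewrite /D.
    have -> : mean (g \o W) = mean (fun t => (W t a)%:R * gb true t) +
        mean (gb false) - mean (fun t => (W t a)%:R * gb false t).
      rewrite -meanD -meanB; apply: eq_mean => t /=.
      rewrite -addrA -[X in _ + (X - _)]mul1r -mulrBl.
      have E b : W t a = b -> gb b t = g (W t).
        move=> Wb; rewrite /gb; congr g; apply/ffunP => i.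
        by rewrite ffunE; case: eqVneq => [->|//].
      by case Wa: (W t a) (E (W t a) erefl) => /= ->; rewrite ?subrr ?subr0; ring.
    have -> : mean (resample q a g \o W) =
       q a false * mean (gb false) + q a true * mean (gb true).
      by rewrite -!meanZ -meanD.
    rewrite !couple /comp/=; ring.
  have pa := p0 a.
  rewrite /err (le_trans (ler_normD _ _))// lerD//; last first.
    by rewrite normrM ler_piMr.
  rewrite (le_trans (ler_normD _ _))// lerD//; last first.
    by rewrite normrM ler_piMr.
  rewrite (le_trans (ler_normB _ _))// !normrM !(ger0_norm pa).
  rewrite -mulrDr [leRHS]mulrCA ler_wpM2l//.
  apply: le_trans (lerD (Db true) (Db false)) _.
  by rewrite -mulrDl; set S := \sum_(_ | _) _; lra.
have telescope s : `|mean (f \o W) - mean (foldr (resample q) f s \o W)| <=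
    \sum_(a <- s) err a /\ forall x, `|foldr (resample q) f s x| <= 1.
  elim: s => [|a s [IH1 IH2]] /=; first by rewrite subrr normr0 big_nil.
  split; last by apply: resample_bound.
  rewrite big_cons [leRHS]addrC; apply: le_trans (lerD IH1 (step a _ IH2)).
  exact: ler_distD.
have [+ _] := telescope (enum I); rewrite big_enum/= -/err.
suff -> : mean (foldr (resample q) f (enum I) \o W) =
   \sum_x f x * \prod_a q a (x a) by [].
rewrite -[RHS](mean_cst _ T0); apply: eq_mean => t /=.
rewrite foldr_resampleE ?enum_uniq//; apply: eq_bigr => x _; congr (_ * _).
by apply: eq_bigr => i _; rewrite mem_enum.
Qed.

End Lindeberg.

(** * Switching an edge into a tuple of permutations *)

Section Edges.
Variables d n : nat.

(** [(l, x, y)] stands for the edge with label [l] from [x] to [y]. *)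
Definition edge : finType := ('I_d * 'I_n * 'I_n)%type.
Definition perms : finType := {ffun 'I_d -> {perm 'I_n}}.

Implicit Types (e f : edge) (E : seq edge) (g : perms).

Definition holds (pi : 'I_d -> {perm 'I_n}) e := pi e.1.1 e.1.2 == e.2.

(** Edges with the same label that share a tail or a head cannot both be present
    unless they are equal, because each label is a permutation. *)
Definition noclash e f :=
  (e.1.1 == f.1.1) ==> (e.1.2 != f.1.2) && (e.2 != f.2).

Lemma noclashC e f : noclash e f = noclash f e.
Proof. by rewrite /noclash eq_sym (eq_sym e.1.2) (eq_sym e.2). Qed.

Lemma holds_noclash pi e f : holds pi e -> holds pi f -> e != f -> noclash e f.
Proof.
case: e f => -[l x] y [[l' x'] y']; rewrite /holds /noclash/= => /eqP <- /eqP <-.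
apply: contraNT; rewrite negb_imply negb_and !negbK => /andP[/eqP <-].
by rewrite (inj_eq perm_inj) orbb => /eqP <-.
Qed.

Definition heads l E : {set 'I_n} :=
  [set y | has (fun e : edge => (e.1.1 == l) && (e.2 == y)) E].

Lemma heads_cat l E F : heads l (E ++ F) = heads l E :|: heads l F.
Proof. by apply/setP => y; rewrite !inE has_cat. Qed.

Lemma card_heads l E : (#|heads l E| <= count (fun e : edge => e.1.1 == l) E)%N.
Proof.
rewrite -size_filter -(size_map (fun e : edge => e.2)).
apply: leq_trans (card_size _); apply/subset_leq_card/fintype.subsetP => y.
rewrite inE => /hasP[e eE /andP[/eqP el /eqP ey]].
by apply/mapP; exists e => //; rewrite mem_filter el eqxx.
Qed.

Lemma card_heads_size l E : (#|heads l E| <= size E)%N.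
Proof. by rewrite (leq_trans (card_heads _ _))// count_size. Qed.

Definition swap l y z g : perms :=
  [ffun m => if m == l then (g m * tperm y z)%g else g m].

(** Creates the edge [e] at the expense of the edge that leaves its tail and of
    the one that enters its head, the loose ends being joined together. *)
Definition switch e g : perms := swap e.1.1 (g e.1.1 e.1.2) e.2 g.

Lemma swapK l y z : involutive (swap l y z).
Proof.
move=> g; apply/ffunP => m; rewrite !ffunE; case: eqP => // _.
by rewrite -mulgA tperm2 mulg1.
Qed.

Lemma holds_switch e g : holds (switch e g) e.
Proof. by rewrite /holds ffunE eqxx permM tpermL. Qed.

Lemma holds_swap l y z g f : (f.1.1 == l) ==> (f.2 != y) && (f.2 != z) ->
  holds (swap l y z g) f = holds g f.
Proof.
rewrite /holds ffunE; case: eqP => //= _ /andP[fy fz].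
rewrite permM -[X in _ == X](@tpermD _ y z f.2) 1?eq_sym//.
by rewrite (inj_eq perm_inj).
Qed.

Lemma switch_keep e f g : noclash e f -> holds g f -> holds (switch e g) f.
Proof.
move=> ef gf; rewrite holds_swap//; apply/implyP => /eqP fl.
move: ef; rewrite /noclash fl eqxx/= => /andP[ef1 ef2].
rewrite [f.2 == e.2]eq_sym ef2 andbT; apply: contra ef1 => /eqP gE.
by move: gf; rewrite /holds fl gE (inj_eq perm_inj) eq_sym.
Qed.

(** Sort the tuples that hold [E] by the current image [y] of the tail of [e].
    No tuple has [y] among the heads already used by [E], and for each of the
    other values exchanging [y] with the head of [e] is a bijection onto the
    tuples that hold [e :: E]. *)
Lemma sum_switch (R : realFieldType) (F : perms -> R) e E : all (noclash e) E ->
  \sum_(g : perms | all (holds g) E) F (switch e g) =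
  (n - #|heads e.1.1 E|)%:R * \sum_(g : perms | all (holds g) (e :: E)) F g.
Proof.
move=> /allP eE; set l := e.1.1; set a := e.1.2; set b := e.2.
rewrite (partition_big (fun g : perms => g l a) predT)//=.
rewrite (bigID (mem (heads l E)))/= big1 ?add0r; last first.
  move=> y; rewrite inE => /hasP[f fE /andP[/eqP fl /eqP fy]].
  apply: big1 => g /andP[/allP/(_ _ fE) gf /eqP ga].
  have := eE _ fE; rewrite /noclash fl eqxx/= => /andP[+ _].
  move: gf; rewrite /holds fl fy -ga (inj_eq perm_inj) => /eqP ->.
  by rewrite eqxx.
rewrite (eq_bigr (fun=> \sum_(g : perms | all (holds g) (e :: E)) F g)).
  rewrite sumr_const mulr_natl; congr (_ *+ _).
  have := cardC (mem (heads l E)); rewrite card_ord.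
  by move/(congr1 (subn^~ #|heads l E|)); rewrite addKn.
move=> y yE; rewrite (reindex_inj (inv_inj (swapK l y b))) /=.
apply: eq_big => [g|g /andP[_ /eqP gy]]; last by rewrite /switch gy swapK.
rewrite [RHS]andbC; congr andb.
  apply: eq_in_all => f fE; apply: holds_swap; apply/implyP => fl.
  apply/andP; split.
    by apply: contra yE => fy; rewrite inE; apply/hasP; exists f => //; rewrite fl fy.
  by have := eE _ fE; rewrite /noclash eq_sym fl/= (eq_sym e.2) => /andP[].
rewrite /holds ffunE eqxx permM -{2}(tpermR y b) (inj_eq perm_inj)//.
Qed.

End Edges.

(** * Coupling with the tuples that hold given edges *)

Section Coupling.
Variables (R : realFieldType) (d n : nat).
Implicit Types (e f : edge d n) (E : seq (edge d n)) (g : perms d n).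

Definition couple E g := foldr (@switch d n) g E.

Definition Pr (A : pred (perms d n)) : R := mean (fun g => (A g)%:R).

Definition Pr_edges E : R := Pr (fun g => all (holds g) E).

Lemma Pr_ge0 A : 0 <= Pr A.
Proof. by apply: mean_ge0 => t; rewrite ler0n. Qed.

Lemma le_Pr (A B : pred (perms d n)) : {subset A <= B} -> Pr A <= Pr B.
Proof.
move=> AB; apply: le_mean => g; rewrite ler_nat.
by have := AB g; rewrite !unfold_in; case: (A g) => //= ->.
Qed.

Lemma eq_Pr (A B : pred (perms d n)) : A =1 B -> Pr A = Pr B.
Proof. by move=> AB; apply: eq_mean => g; rewrite AB. Qed.

Lemma meanE (A : pred (perms d n)) F : mean (fun g => (A g)%:R * F g) =
  (\sum_(g : perms d n | A g) F g) / #|perms d n|%:R :> R.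
Proof.
rewrite /mean [in RHS]big_mkcond/=; congr (_ / _); apply: eq_bigr => g _.
by case: (A g); rewrite ?mul1r ?mul0r.
Qed.

Lemma card_perms_gt0 : (0 < #|perms d n|)%N.
Proof. by apply/card_gt0P; exists [ffun=> 1%g]. Qed.

Lemma mean_switch F e E : all (noclash e) E ->
  mean (fun g => (all (holds g) E)%:R * F (switch e g)) =
  (n - #|heads e.1.1 E|)%:R * mean (fun g => (all (holds g) (e :: E))%:R * F g) :> R.
Proof.
by move=> eE; rewrite (meanE (fun g => all (holds g) E)) sum_switch// -mulrA -meanE.
Qed.

(** The image of a fresh tail is uniform among the values that [E] leaves free. *)
Lemma Pr_edges_cons e E : all (noclash e) E ->
  Pr_edges E = (n - #|heads e.1.1 E|)%:R * Pr_edges (e :: E).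
Proof.
move=> eE; have := mean_switch (fun=> 1) eE.
have M (A : pred (perms d n)) : mean (fun g : perms d n => (A g)%:R * 1) = Pr A.
  by apply: eq_mean => g; rewrite mulr1.
by rewrite !M.
Qed.

Lemma Pr_edges_nil : Pr_edges [::] = 1.
Proof. by rewrite /Pr_edges /Pr /= mean_cst// card_perms_gt0. Qed.

Lemma heads_lt e E : all (noclash e) E -> (#|heads e.1.1 E| < n)%N.
Proof.
move=> /allP eE; rewrite -[X in (_ < X)%N]card_ord -[X in (_ < X)%N]cardsT.
apply: proper_card; rewrite properE finset.subsetT/=; apply/subsetPn; exists e.2 => //.
rewrite inE; apply/hasPn => f /eE; rewrite /noclash eq_sym (eq_sym f.2).
by case: eqP => //= _ /andP[_ /negbTE ->].
Qed.

(** By [sum_switch], switching [e] into a uniform tuple that holds [E] gives a uniform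
    tuple that holds [e :: E].  Hence, for uniform [g], [couple E g] has the
    conditional law of [g] given that it holds [E]. *)
Lemma mean_couple E F : pairwise (@noclash d n) E ->
  mean (fun g => (all (holds g) E)%:R * F g) = Pr_edges E * mean (F \o couple E).
Proof.
elim: E F => [|e E IH] F /=.
  by move=> _; rewrite Pr_edges_nil mul1r; apply: eq_mean => g; rewrite mul1r.
case/andP => eE pE.
have n0 : (n - #|heads e.1.1 E|)%:R != 0 :> R.
  by rewrite pnatr_eq0 subn_eq0 -ltnNge heads_lt.
apply: (mulfI n0); rewrite -(mean_switch F eE) IH// (Pr_edges_cons eE).
by rewrite -mulrA.
Qed.

(** This monotonicity is what makes the coupling useful: it can only destroy
    edges that compete with [E] for a tail or a head. *)
Lemma couple_keep E f g : all (noclash f) E -> holds g f -> holds (couple E g) f.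
Proof.
elim: E => //= e E IH /andP[fe fE] gf.
by apply: switch_keep; [rewrite noclashC|exact: IH].
Qed.

Lemma Pr_edges_cons_le e E k : all (noclash e) E -> (size E <= k)%N ->
  (n - k)%:R * Pr_edges (e :: E) <= Pr_edges E.
Proof.
move=> eE Ek; rewrite (Pr_edges_cons eE) ler_wpM2r ?Pr_ge0// ler_nat leq_sub2l//.
exact: leq_trans (card_heads_size _ _) Ek.
Qed.

(** Either [e] is compatible with [E] and the bound counts the values that are
    still free, or it is not and the probability on the left vanishes. *)
Lemma Pr_edges_fresh e E k : e \notin E -> (size E <= k)%N ->
  (n - k)%:R * Pr_edges (e :: E) <= Pr_edges E.
Proof.
move=> eE Ek; have [|/allPn[f fE ef]] := boolP (all (noclash e) E).
  by move/Pr_edges_cons_le => /(_ _ Ek).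
suff -> : Pr_edges (e :: E) = 0 by rewrite mulr0 Pr_ge0.
rewrite /Pr_edges /Pr /mean big1 ?mul0r// => g _.
case: (boolP (all _ _)) => //= /andP[ge /allP/(_ _ fE) gf].
rewrite (holds_noclash ge gf) // in ef.
by apply: contraNneq eE => ->.
Qed.

Lemma Pr_edges_le E : pairwise (@noclash d n) E -> (n ^_ (size E))%:R * Pr_edges E <= 1.
Proof.
elim: E => [_|e E IH] /=; first by rewrite ffactn0 mul1r Pr_edges_nil.
case/andP => eE /IH; apply: le_trans; rewrite ffactnSr natrM -mulrA.
by rewrite ler_wpM2l// Pr_edges_cons_le.
Qed.

Lemma Pr_edges_ge E : pairwise (@noclash d n) E -> 1 <= (n ^ size E)%:R * Pr_edges E.
Proof.
elim: E => [_|e E IH] /=; first by rewrite expn0 mul1r Pr_edges_nil.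
case/andP => eE /IH /le_trans; apply; rewrite expnSr natrM -mulrA.
by rewrite ler_wpM2l// (Pr_edges_cons eE) ler_wpM2r ?Pr_ge0// ler_nat leq_subr.
Qed.

(** Nearly independent: adding the edges of [F] one by one, the two sides pick
    up the factors [1 / (n - h)] and [1 / (n - h')], where [h] and [h'] count the
    heads used so far with the same label, with and without [E]; they differ by
    the edges of [E] with that label.  It matters for the final exponent that
    only pairs of edges with equal labels contribute. *)
Lemma Pr_edges_cat_le E F r : pairwise (@noclash d n) F ->
  (forall f, f \in F -> all (noclash f) E) -> (size F <= r < n)%N ->
  Pr_edges (F ++ E) <= Pr_edges E * Pr_edges F +
    Pr_edges (F ++ E) *
    \sum_(f <- F) (count (fun e => e.1.1 == f.1.1) E)%:R / (n - r)%:R.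
Proof.
move=> pF FE /andP[Fr rn].
have nr0 : 0 < (n - r)%:R :> R by rewrite ltr0n subn_gt0.
suff : Pr_edges (F ++ E) * (1 - \sum_(f <- F)
    (count (fun e => e.1.1 == f.1.1) E)%:R / (n - r)%:R) <=
    Pr_edges E * Pr_edges F by lra.
elim: F pF FE Fr => [|f F IH] /=.
  by rewrite big_nil subr0 Pr_edges_nil.
case/andP => fF pF FE Fr; rewrite big_cons.
have {}IH := IH pF (fun f' f'F => FE f' (mem_behead (s := f :: F) f'F)) (ltnW Fr).
have fFE : all (noclash f) (F ++ E) by rewrite all_cat fF FE// mem_head.
move: IH; rewrite (Pr_edges_cons fFE) (Pr_edges_cons fF).
set S := \sum_(_ <- _) _; set a := count _ E.
have S0 : 0 <= S by apply: sumr_ge0 => i _; rewrite divr_ge0.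
have P'0 : 0 <= Pr_edges (f :: F ++ E) by exact: Pr_ge0.
have P''0 : 0 <= Pr_edges (f :: F) by exact: Pr_ge0.
have PE0 : 0 <= Pr_edges E by exact: Pr_ge0.
set P' := Pr_edges _ in P'0 *; set P'' := Pr_edges (f :: F) in P''0 *.
set c1 := (n - #|heads _ (F ++ E)|)%N; set c2 := (n - #|heads _ F|)%N => IH.
have c12 : (c2%:R - a%:R <= c1%:R :> R).
  rewrite lerBlDr -natrD ler_nat /c1 /c2 heads_cat.
  have hE : (#|heads f.1.1 E| <= a)%N by exact: card_heads.
  have [+ _] := leq_card_setU (heads f.1.1 F) (heads f.1.1 E).
  move: hE; move: #|heads _ E| #|heads _ F| #|_ :|: _| => x y z; lia.
have c2r : (n - r)%:R <= c2%:R :> R.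
  by rewrite ler_nat leq_sub2l// (leq_trans (card_heads_size _ _))// ltnW.
have a0 : 0 <= a%:R :> R by [].
(* If [S] exceeds 1 the left-hand side is negative. *)
have [S1|S1] := leP 1 S.
  have : 0 <= a%:R / (n - r)%:R :> R by rewrite divr_ge0.
  have : 0 <= Pr_edges E * P'' by rewrite mulr_ge0.
  by set t := a%:R / _ => *; nra.
have c20 : 0 < c2%:R :> R by exact: lt_le_trans c2r.
rewrite -(ler_pM2l c20) [leRHS]mulrCA; apply: le_trans IH.
rewrite mulrCA [leRHS]mulrAC mulrC ler_wpM2r//.
set t := a%:R / _.
have : a%:R <= c2%:R * t.
  by rewrite /t mulrCA ler_peMr// ler_pdivlMr// mul1r.
by move=> ?; nra.
Qed.

End Coupling.

(** * Edges of a walk *)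

Section WalkEdges.
Variables d n k : nat.
Implicit Types (q : walk d n k) (i j : 'I_k).

(** A step labelled [(l, true)] runs through its edge backwards. *)
Definition step_edge q i : edge d n :=
  if (q.2 i).2 then ((q.2 i).1, q.1 (ordS i), q.1 i)
  else ((q.2 i).1, q.1 i, q.1 (ordS i)).

Definition walk_edges q : seq (edge d n) := [seq step_edge q i | i <- enum 'I_k].

Lemma step_edge_label q i : (step_edge q i).1.1 = (q.2 i).1.
Proof. by rewrite /step_edge; case: ifP. Qed.

Lemma size_walk_edges q : size (walk_edges q) = k.
Proof. by rewrite size_map size_enum_ord. Qed.

Lemma step_edge_in q i : step_edge q i \in walk_edges q.
Proof. by rewrite map_f// mem_enum. Qed.

Lemma holds_step_edge (pi : perm_graph d n) q i :
  holds pi (step_edge q i) = (letter_perm pi (q.2 i) (q.1 i) == q.1 (ordS i)).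
Proof.
rewrite /holds /step_edge /letter_perm; case: ifP => //= _.
by rewrite (canF_eq (permKV _)) eq_sym.
Qed.

Lemma all_holds_walk_edges (pi : perm_graph d n) q :
  all (holds pi) (walk_edges q) = follows pi q.
Proof.
rewrite all_map; apply/allP/forallP => [h i|h i _] /=.
  by have := h i; rewrite mem_enum/= holds_step_edge; apply.
by rewrite holds_step_edge h.
Qed.

(** Equal signs are settled by the distinctness of the vertices.  For opposite
    signs a shared tail or head forces the two steps to be consecutive, and they
    would then cancel in the word. *)
Lemma cycle_noclash q i j : is_cycle q -> i != j ->
  noclash (step_edge q i) (step_edge q j).
Proof.
case/andP => /injectiveP qi /forallP red ij.
have Sij : ordS i != ordS j by rewrite (can_eq (@ordSK k)).
have opp (i' j' : 'I_k) : (q.2 i').1 = (q.2 j').1 -> (q.2 i').2 != (q.2 j').2 ->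
    i' != ordS j'.
  move=> e1 e2; apply: contraNneq (red j') => <-.
  case: (q.2 i') (q.2 j') e1 e2 => l b [l' b'] /= -> bb.
  by apply/eqP; congr pair; case: b b' bb => -[].
rewrite /noclash !step_edge_label; apply/implyP => /eqP l.
have /= o1 := opp i j l; have /= o2 := opp j i (esym l).
rewrite /step_edge; move: o1 o2.
case: (q.2 i).2; case: (q.2 j).2 => /= o1 o2;
  rewrite !(inj_eq qi) ?ij ?Sij//.
  by rewrite eq_sym o2//= o1.
by rewrite o1//= eq_sym o2.
Qed.

Lemma pairwise_walk_edges q : is_cycle q -> pairwise (@noclash d n) (walk_edges q).
Proof.
move=> qc; rewrite pairwise_map; have := enum_uniq 'I_k.
rewrite uniq_pairwise; apply: sub_pairwise => i j /=; exact: cycle_noclash.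
Qed.

Lemma step_edge_inj q i j : is_cycle q -> step_edge q i = step_edge q j -> i = j.
Proof.
move=> qc ij; apply/eqP; apply: contraT => /(cycle_noclash qc).
by rewrite ij /noclash eqxx/= eqxx.
Qed.

End WalkEdges.

(** * Exploring a walk with a given word *)

Section Explore.
Variables (R : realFieldType) (d n m : nat).
Implicit Types (q : walk d n m.+1) (g : perms d n).

Definition front_edges q : seq (edge d n) :=
  [seq step_edge q i | i <- rem ord_max (enum 'I_m.+1)].

Lemma size_front_edges q : size (front_edges q) = m.
Proof. by rewrite size_map size_rem ?mem_enum// size_enum_ord. Qed.

Lemma walk_edges_perm q : perm_eq (walk_edges q) (step_edge q ord_max :: front_edges q).
Proof. by rewrite -map_cons perm_map// perm_to_rem// mem_enum. Qed.

Lemma holds_front_edges g q : all (holds g) (front_edges q) ->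
  forall i : 'I_m.+1, i != ord_max ->
  letter_perm g (q.2 i) (q.1 i) = q.1 (ordS i).
Proof.
move=> /allP gq i im; apply/eqP; rewrite -holds_step_edge; apply: gq.
by apply: map_f; rewrite mem_rem_uniq ?enum_uniq// inE im mem_enum.
Qed.

(** Each vertex is the image of the previous one under the letter between them. *)
Lemma front_edges_inj g q q' :
  all (holds g) (front_edges q) -> all (holds g) (front_edges q') ->
  q.1 ord0 = q'.1 ord0 -> q.2 = q'.2 -> q = q'.
Proof.
move=> /holds_front_edges h /holds_front_edges h' e0 e2.
suff e1 : q.1 = q'.1 by rewrite [q]surjective_pairing e1 e2 -surjective_pairing.
apply/ffunP => -[i im]; elim: i im => [|i IH] im.
  by rewrite (_ : Ordinal im = ord0)//; exact: val_inj.
have im' : (i < m.+1)%N by exact: ltnW.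
have S : Ordinal im = ordS (Ordinal im') by apply: val_inj; rewrite /= modn_small.
have imax : Ordinal im' != ord_max by rewrite -val_eqE/= ltn_eqF.
by rewrite S -h// -h'// e2 IH.
Qed.

(** Fix the starting vertex [u] and the word [w].  All edges but the last are
    then dictated by the permutations, so that summing over the intermediate
    vertices costs nothing; the last edge is fresh, and hits the prescribed
    vertex [u] with probability at most [1 / (n - K)].  This single estimate
    replaces a count of all the ways in which two cycles may overlap. *)
Lemma explore (E0 : seq (edge d n)) u w K : (size E0 + m <= K)%N ->
  (n - K)%:R * \sum_(q : walk d n m.+1 | [&& is_cycle q, q.1 ord0 == u, q.2 == w
       & step_edge q ord_max \notin E0])
     Pr R (fun g => all (holds g) E0 && follows g q) <= Pr_edges R E0.
Proof.
move=> EK; rewrite mulr_sumr.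
pose c q := [&& is_cycle q, q.1 ord0 == u, q.2 == w & step_edge q ord_max \notin E0].
have step q : c q ->
    (n - K)%:R * Pr R (fun g => all (holds g) E0 && follows g q) <=
    Pr R (fun g => all (holds g) E0 && all (holds g) (front_edges q)).
  case/and4P => qc _ _ last.
  have -> : Pr R (fun g => all (holds g) E0 && follows g q) =
      Pr_edges R (step_edge q ord_max :: (E0 ++ front_edges q)).
    apply: eq_Pr => g; rewrite -all_holds_walk_edges (perm_all _ (walk_edges_perm q)).
    by rewrite /= all_cat andbCA.
  apply: le_trans (Pr_edges_fresh _ _ _) _; last by
    apply/le_Pr => g; rewrite !unfold_in all_cat.
  - rewrite mem_cat (negbTE last)/=; apply/mapP => -[i].
    rewrite mem_rem_uniq ?enum_uniq// inE => /andP[im _] /(step_edge_inj qc) me.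
    by rewrite me eqxx in im.
  - by rewrite size_cat size_front_edges.
apply: le_trans (ler_sum _ step) _; rewrite /Pr -mean_sum.
apply: le_mean => g; case: (boolP (all (holds g) E0)) => gE /=; last by rewrite big1.
rewrite -natr_sum ler_nat.
rewrite (_ : (\sum_(q | _) _)%N = #|[pred q | c q && all (holds g) (front_edges q)]|).
  apply/card_le1_eqP => q q'; rewrite !unfold_in.
  move=> /andP[/and4P[_ /eqP u1 /eqP w1 _] f1] /andP[/and4P[_ /eqP u2 /eqP w2 _] f2].
  by apply: (front_edges_inj f2 f1); rewrite ?u1 ?w1.
by rewrite -sum1_card [RHS]big_mkcondr; apply: eq_bigr => q _; case: all.
Qed.

End Explore.

(** * Counting reduced words *)

Lemma card_letter d : #|letter d| = (2 * d)%N.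
Proof. by rewrite card_prod card_ord card_bool mulnC. Qed.

(** A path is determined by its first point and, at each step, by the rank of
    the next point among the at most [B] allowed ones. *)
Lemma card_paths (L : finType) (r : rel L) (B m : nat) (a : L) :
  (forall x, #|r x| <= B)%N ->
  (#|[set w : {ffun 'I_m.+1 -> L} | (w ord0 == a) &&
     [forall i, (i != ord_max) ==> r (w i) (w (ordS i))]]| <= B ^ m)%N.
Proof.
case: B => [|B] rB.
  case: m => [|m].
    apply/card_le1_eqP => w w'; rewrite !inE => /andP[/eqP w0 _] /andP[/eqP w0' _].
    by apply/ffunP => i; rewrite ord1 w0 w0'.
  rewrite exp0n// leqn0 cards_eq0; apply/eqP/setP => w; rewrite !inE.
  apply/negbTE; rewrite negb_and; apply/orP; right; apply/forallPn; exists ord0.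
  rewrite negb_imply/=; apply/negP => rw.
  have := rB (w ord0); rewrite leqn0 => /eqP/card0_eq/(_ (w (ordS ord0))).
  by rewrite unfold_in rw.
(* [prev i] and [next i] are the positions before and after the step [i]. *)
pose next (i : 'I_m) := (@lift m.+1 ord0 i).
pose prev (i : 'I_m) : 'I_m.+1 := widen_ord (leqnSn m) i.
have next_prev i : next i = ordS (prev i).
  by apply: val_inj; rewrite /= modn_small// ltnS ltn_ord.
pose code (w : {ffun 'I_m.+1 -> L}) : {ffun 'I_m -> 'I_B.+1} :=
  [ffun i => inord (index (w (next i)) (enum (r (w (prev i)))))].
have <- : #|{ffun 'I_m -> 'I_B.+1}| = (B.+1 ^ m)%N by rewrite card_ffun !card_ord.
rewrite -(@card_in_imset _ _ code); first exact: max_card.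
move=> w w'; rewrite !inE.
move=> /andP[/eqP w0 /forallP rw] /andP[/eqP w0' /forallP rw'] cww'.
apply/ffunP => -[i im]; elim: i im => [|i IH] im.
  by rewrite (_ : Ordinal im = ord0) ?w0 ?w0'//; exact: val_inj.
have im1 : (i < m)%N by [].
have -> : Ordinal im = next (Ordinal im1) by exact: val_inj.
have IHi : w (prev (Ordinal im1)) = w' (prev (Ordinal im1)).
  rewrite (_ : prev _ = Ordinal (ltnW im)) ?IH//; exact: val_inj.
have last : prev (Ordinal im1) != ord_max by rewrite -val_eqE/= ltn_eqF.
have := rw (prev (Ordinal im1)); have := rw' (prev (Ordinal im1)).
rewrite -!next_prev last/= -IHi => r2 r1.
move: cww' => /ffunP/(_ (Ordinal im1)); rewrite !ffunE -IHi => /(congr1 val)/=.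
have inr x : r (w (prev (Ordinal im1))) x -> x \in enum (r (w (prev (Ordinal im1)))).
  by rewrite mem_enum.
rewrite !inordK; first by apply: index_inj => //; exact: inr.
all: by rewrite (leq_trans _ (rB (w (prev (Ordinal im1)))))// cardE index_mem inr.
Qed.

Lemma card_reduced d m (a : letter d) :
  (#|[set w : {ffun 'I_m.+1 -> letter d} | cyclically_reduced w && (w ord0 == a)]|
     <= (2 * d - 1) ^ m)%N.
Proof.
pose r (x y : letter d) := x != letter_inv y.
have rB x : (#|r x| <= 2 * d - 1)%N.
  rewrite -card_letter subn1 -(cardC1 (letter_inv x)).
  apply/subset_leq_card/fintype.subsetP => y.
  rewrite !unfold_in/= /r; apply: contraNneq => ->.
  by rewrite letter_invK.
apply: leq_trans (card_paths m a rB); apply/subset_leq_card/fintype.subsetP => w.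
rewrite !inE => /andP[/forallP red ->] /=.
by apply/forallP => i; apply/implyP => _; exact: red.
Qed.

(** * Representatives of a labeled cycle *)

Section Classes.
Variables d n m : nat.
Implicit Types (p q y : walk d n m.+1) (a b : labeled_cycle d n m.+1).

Lemma is_cycle_rotate q : is_cycle q -> is_cycle (rotate q).
Proof.
case/andP => /injectiveP qi /forallP red; apply/andP; split.
  by apply/injectiveP => i j; rewrite !ffunE => /qi/ordS_inj.
by apply/forallP => i; rewrite !ffunE.
Qed.

Lemma is_cycle_iter_rotate j q : is_cycle q -> is_cycle (iter j (@rotate _ _ _) q).
Proof. by move=> qc; elim: j => //= j; exact: is_cycle_rotate. Qed.

Lemma is_cycle_reverse q : is_cycle q -> is_cycle (reverse q).
Proof.
case/andP => /injectiveP qi /forallP red; apply/andP; split.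
  by apply/injectiveP => i j; rewrite !ffunE => /qi/ordS_inj/rev_ord_inj.
apply/forallP => i; rewrite !ffunE letter_invK rev_ordS.
by have := red (ord_pred (rev_ord i)); rewrite ord_predK eq_sym.
Qed.

Lemma same_cycle_refl q : same_cycle q q.
Proof. by have [] := same_cycle_equiv (d:=d) (n:=n) (ltn0Sn m) q q q. Qed.

Lemma partition_cycles :
  finset.partition (labeled_cycles d n m.+1) [set p | is_cycle p].
Proof.
by apply: equivalence_partitionP => p q r _ _ _; exact: same_cycle_equiv.
Qed.

Lemma class_ex a : exists q, q \in val a.
Proof.
have /and3P[_ _ n0] := partition_cycles; apply/set0Pn.
by apply: contraNneq n0 => <-; exact: valP.
Qed.

Definition rep a := xchoose (class_ex a).

Lemma rep_in a : rep a \in val a.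
Proof. exact: xchooseP. Qed.

Lemma classE a q : q \in val a -> val a = [set y | is_cycle y && same_cycle q y].
Proof.
have /imsetP[x xc ->] := valP a; rewrite inE => /andP[_ xq].
apply/setP => y; rewrite !inE.
by have [_ /(_ xq) ->] := same_cycle_equiv (ltn0Sn m) x q y.
Qed.

Lemma class_cycle a q : q \in val a -> is_cycle q.
Proof. by have /imsetP[x xc ->] := valP a; rewrite !inE => /andP[]. Qed.

Lemma class_same a q y : q \in val a -> (y \in val a) = is_cycle y && same_cycle q y.
Proof. by move=> qa; rewrite (classE qa) inE. Qed.

Lemma class_inj a b q y : q \in val a -> y \in val b -> same_cycle q y -> a = b.
Proof.
move=> qa yb qy; apply: val_inj; rewrite (classE qa) (classE yb).
apply/setP => z; rewrite !inE.
by have [_ /(_ qy) ->] := same_cycle_equiv (ltn0Sn m) q y z.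
Qed.

Lemma class_rotate a q j : q \in val a -> iter j (@rotate _ _ _) q \in val a.
Proof.
move=> qa; rewrite (class_same _ qa) is_cycle_iter_rotate ?(class_cycle qa)//=.
by apply/(same_cycleP _ _ (ltn0Sn m)); exists j; left.
Qed.

Lemma class_reverse a q : q \in val a -> reverse q \in val a.
Proof.
move=> qa; rewrite (class_same _ qa) is_cycle_reverse ?(class_cycle qa)//=.
by apply/(same_cycleP _ _ (ltn0Sn m)); exists 0%N; right.
Qed.

Lemma containsE (pi : perm_graph d n) a q :
  q \in val a -> contains pi a = follows pi q.
Proof.
move=> qa; apply/existsP/idP => [[y /andP[ya]]|]; last by exists q; rewrite qa.
move: ya; rewrite (class_same _ qa) => /andP[_ /(follows_same_cycle pi) ->].
by [].
Qed.

Lemma sum_class (R : nmodType) (H : walk d n m.+1 -> R) :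
  \sum_(q | is_cycle q) H q =
  \sum_(a : labeled_cycle d n m.+1) \sum_(q in val a) H q.
Proof.
rewrite -(big_sub (labeled_cycles d n m.+1) (fun A => \sum_(q in A) H q)).
rewrite -(set_partition_big (labeled_cycles d n m.+1) partition_cycles).
by apply: eq_bigl => q; rewrite inE.
Qed.

(** A dart is a vertex together with a letter, that is, an edge with a direction
    of traversal. *)
Definition first_dart q : 'I_n * letter d := (q.1 ord0, q.2 ord0).

Lemma iter_ordS0 (j : 'I_m.+1) : iter j (@ordS m.+1) ord0 = j.
Proof. by apply: val_inj; rewrite /= iter_ordS add0n modn_small. Qed.

Lemma first_dart_rotate q (j : 'I_m.+1) :
  first_dart (iter j (@rotate _ _ _) q) = (q.1 j, q.2 j).
Proof. by rewrite iter_rotate /first_dart !ffunE iter_ordS0. Qed.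

Lemma first_dart_reverse q (j : 'I_m.+1) :
  first_dart (iter (rev_ord j) (@rotate _ _ _) (reverse q)) =
  (q.1 (ordS j), letter_inv (q.2 j)).
Proof. by rewrite first_dart_rotate !ffunE rev_ordK. Qed.

(** The rotations of [q] start at distinct vertices, so the class of [q] contains
    one representative for each position along the cycle. *)
Lemma sum_rotations (R : numDomainType) (h : 'I_n * letter d -> R) a q :
  (forall x, 0 <= h x) -> q \in val a ->
  \sum_j h (q.1 j, q.2 j) <= \sum_(y in val a) h (first_dart y).
Proof.
move=> h0 qa; have /andP[/injectiveP qi _] := class_cycle qa.
pose rot (j : 'I_m.+1) := iter j (@rotate _ _ _) q.
have roti : injective rot.
  by move=> i j /(congr1 first_dart); rewrite !first_dart_rotate => -[/qi].
rewrite (eq_bigr (h \o first_dart \o rot)) => [|j _]; last first.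
  by rewrite /= first_dart_rotate.
rewrite -(big_imset (h \o first_dart))/=; last by move=> i j _ _; exact: roti.
rewrite [leRHS](bigID (mem (rot @: predT)))/= -[leLHS]addr0 lerD ?sumr_ge0//.
rewrite le_eqVlt; apply/orP; left; apply/eqP; apply: eq_bigl => y.
rewrite andb_idl// => /imsetP[j _ ->]; exact: class_rotate.
Qed.

(** The darts that traverse [e], one in each direction. *)
Definition edge_darts (e : edge d n) : seq ('I_n * letter d) :=
  [:: (e.1.2, (e.1.1, false)); (e.2, (e.1.1, true))].

Definition darts (E : seq (edge d n)) := flatten [seq edge_darts e | e <- E].

Lemma size_darts E : size (darts E) = (2 * size E)%N.
Proof.
by elim: E => //= e E IH; rewrite mulnS -IH.
Qed.

Lemma edge_darts_step q j :
  (q.1 j, q.2 j) \in edge_darts (step_edge q j) /\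
  (q.1 (ordS j), letter_inv (q.2 j)) \in edge_darts (step_edge q j).
Proof.
rewrite /edge_darts /step_edge !inE /letter_inv; case: (q.2 j) => l [] /=.
  by rewrite !eqxx ?orbT.
by rewrite !eqxx ?orbT.
Qed.

(** Rotations start at any vertex of the cycle, and reversed rotations traverse
    any step backwards. *)
Lemma class_first_dart a q j x : q \in val a -> x \in edge_darts (step_edge q j) ->
  exists2 y, y \in val a & first_dart y = x.
Proof.
move=> qa xq.
have rot : exists2 y, y \in val a & first_dart y = (q.1 j, q.2 j).
  by exists (iter j (@rotate _ _ _) q); rewrite ?class_rotate ?first_dart_rotate.
have rev : exists2 y, y \in val a & first_dart y = (q.1 (ordS j), letter_inv (q.2 j)).
  exists (iter (rev_ord j) (@rotate _ _ _) (reverse q)); last first.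
    by rewrite first_dart_reverse.
  exact/class_rotate/class_reverse.
move: xq rot rev; rewrite /edge_darts /step_edge !inE /letter_inv.
by case: (q.2 j) => l [] /= /orP[] /eqP e; subst x.
Qed.

End Classes.

(** * Expected number of cycles through given darts *)

Section ClassBound.
Variables (R : realFieldType) (d n m : nat).

(** [explore], summed over the words that start with the letter of [x]. *)
Lemma start_sum (E0 : seq (edge d n)) x K : (size E0 + m <= K)%N ->
  (n - K)%:R * \sum_(q : walk d n m.+1 | [&& is_cycle q, first_dart q == x
       & step_edge q ord_max \notin E0])
     Pr R (fun g => all (holds g) E0 && follows g q) <=
  ((2 * d - 1) ^ m)%:R * Pr_edges R E0.
Proof.
move=> EK; pose W := [set w : {ffun 'I_m.+1 -> letter d} | cyclically_reduced w
  && (w ord0 == x.2)].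
rewrite (partition_big (fun q : walk d n m.+1 => q.2) (mem W))/=; last first.
  by move=> q /and3P[/andP[_ qr] /eqP e _]; rewrite inE qr -e/= eqxx.
rewrite mulr_sumr.
apply: (@le_trans _ _ (\sum_(w in W) Pr_edges R E0)).
  apply: ler_sum => w _; apply: le_trans (explore R x.1 w EK).
  rewrite ler_wpM2l//; rewrite [leLHS]big_mkcond [leRHS]big_mkcond/=.
  apply: ler_sum => q _.
  have -> : (first_dart q == x) = (q.1 ord0 == x.1) && (q.2 ord0 == x.2).
    by case: x {W}.
  have := Pr_ge0 R (fun g => all (holds g) E0 && follows g q).
  by case: (is_cycle q); case: (q.2 == w); case: (_ \notin _);
    case: (q.1 ord0 == x.1); case: (q.2 ord0 == x.2).
rewrite sumr_const -(mulr_natl (Pr_edges R E0)) ler_wpM2r ?Pr_ge0//.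
by rewrite ler_nat; exact: card_reduced.
Qed.

(** Here [c b] is any statistic of the cycle [b] that can be detected on its
    representatives starting along a dart of [D] and ending outside [E0].  The
    cycles that share a dart or an edge with a given one, the pairs of
    edges with equal labels and the mean number of cycles are all of this kind. *)
Lemma class_bound (E0 : seq (edge d n)) (D : seq ('I_n * letter d)) K
    (c : labeled_cycle d n m.+1 -> R) : (size E0 + m <= K)%N ->
  (forall b, c b <= \sum_(q in val b)
     (count_mem (first_dart q) D)%:R * (step_edge q ord_max \notin E0)%:R) ->
  (n - K)%:R * \sum_b c b * Pr R (fun g => all (holds g) E0 && contains g b) <=
  (size D)%:R * ((2 * d - 1) ^ m)%:R * Pr_edges R E0.
Proof.
move=> EK cb.
pose X (q : walk d n m.+1) := Pr R (fun g => all (holds g) E0 && follows g q).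
have XE (b : labeled_cycle d n m.+1) q : q \in val b ->
    Pr R (fun g => all (holds g) E0 && contains g b) = X q.
  by move=> qb; apply: eq_Pr => g; rewrite (containsE _ qb).
apply: (@le_trans _ _ ((n - K)%:R * \sum_(q : walk d n m.+1 | is_cycle q)
   \sum_(x <- D) (first_dart q == x)%:R * (step_edge q ord_max \notin E0)%:R * X q)).
  rewrite ler_wpM2l// sum_class ler_sum// => b _.
  apply: le_trans (ler_wpM2r (Pr_ge0 _ _) (cb b)) _.
  rewrite mulr_suml ler_sum// => q qb; rewrite (XE _ _ qb) -!mulr_suml.
  rewrite -natr_sum -big_mkcond sum1_count.
  by rewrite (eq_count (a2 := pred1 (first_dart q)))// => x /=; rewrite eq_sym.
rewrite exchange_big/= mulr_sumr -mulrA mulr_natl.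
rewrite -[leRHS]iter_addr_0 -(count_predT D) -big_const_seq.
apply: ler_sum => x _; apply: le_trans (start_sum x EK).
rewrite ler_wpM2l// big_mkcond [leRHS]big_mkcond/= ler_sum// => q _.
case: is_cycle => //=; case: (first_dart q == x) => /=; rewrite ?mul0r//.
by case: (_ \notin _); rewrite /= ?mulr0 ?mul0r// !mul1r.
Qed.

End ClassBound.

(** * A cycle whose edges lie in another cycle *)

Section EdgesOfClass.
Variables d n m : nat.
Implicit Types (p q y : walk d n m.+1) (a b : labeled_cycle d n m.+1).

Lemma step_edge_rotate t q i :
  step_edge (iter t (@rotate _ _ _) q) i = step_edge q (iter t (@ordS m.+1) i).
Proof. by rewrite iter_rotate /step_edge /= !ffunE -iterSr iterS. Qed.

Lemma step_edge_reverse q i : step_edge (reverse q) i = step_edge q (rev_ord i).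
Proof.
rewrite /step_edge /= !ffunE rev_ordS ord_predK /letter_inv /=.
by case: (q.2 _) => l [].
Qed.

Lemma walk_edges_class a q y : q \in val a -> y \in val a ->
  {subset walk_edges y <= walk_edges q}.
Proof.
move=> qa; rewrite (class_same _ qa) => /andP[_ /(same_cycleP _ _ (ltn0Sn m))[t]].
move=> [] -> e /mapP[i _ ->]; rewrite step_edge_rotate ?step_edge_reverse;
  exact: step_edge_in.
Qed.

Lemma edge_darts_cases q j x : x \in edge_darts (step_edge q j) ->
  x = (q.1 j, q.2 j) \/ x = (q.1 (ordS j), letter_inv (q.2 j)).
Proof.
rewrite /edge_darts /step_edge !inE /letter_inv.
by case: (q.2 j) => l [] /= /orP[] /eqP ->; [right|left|left|right].
Qed.

(** Otherwise the complement of [A] would be stable under [ordS], hence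
    everything. *)
Lemma cyclic_switch (A : pred 'I_m.+1) i j : A i -> ~~ A j ->
  exists2 t, A t & ~~ A (ord_pred t).
Proof.
move=> Ai Aj; apply/exists_inP; apply: contraT => /exists_inPn H.
suff /negP : ~~ A i by [].
have {}H t : ~~ A t -> ~~ A (ordS t).
  by move=> At; apply/negP => /H; rewrite ordSK At.
have iter_H s : ~~ A (iter s (@ordS _) j) by elim: s => //= s; exact: H.
have -> : i = iter (i + m.+1 - j) (@ordS _) j.
  apply: val_inj; rewrite /= iter_ordS subnKC ?modnDr ?modn_small//.
  by rewrite (leq_trans (ltnW (ltn_ord j)))// leq_addl.
exact: iter_H.
Qed.

Lemma last_edge_rotate q (t : 'I_m.+1) :
  step_edge (iter t (@rotate _ _ _) q) ord_max = step_edge q (ord_pred t).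
Proof.
rewrite step_edge_rotate; congr step_edge; apply: val_inj.
by rewrite /= iter_ordS /= addnS addnC.
Qed.

End EdgesOfClass.

(** Let all edges of the cycle [q] be edges of the cycle [p], with the same first
    dart.  Each vertex of [p] meets only two edges of [p]; having arrived along
    one of them, [q] must leave along the other since its word is reduced.  So
    [q] follows [p] for ever, and both have the same period. *)
Section SubCycle.
Variables (d n m m' : nat) (p : walk d n m.+1) (q : walk d n m'.+1).
Hypotheses (pc : is_cycle p) (qc : is_cycle q).
Hypothesis first : first_dart q = first_dart p.
Hypothesis sub : {subset walk_edges q <= walk_edges p}.

Let p_inj : injective p.1. Proof. by apply/injectiveP; case/andP: pc. Qed.
Let q_inj : injective q.1. Proof. by apply/injectiveP; case/andP: qc. Qed.
Let p_red j : p.2 j <> letter_inv (p.2 (ordS j)).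
Proof. by case/andP: pc => _ /forallP/(_ j)/eqP. Qed.
Let q_red j : q.2 j <> letter_inv (q.2 (ordS j)).
Proof. by case/andP: qc => _ /forallP/(_ j)/eqP. Qed.

Let dart_in i : exists2 j, step_edge q i = step_edge p j &
  (q.1 i, q.2 i) = (p.1 j, p.2 j) \/
  (q.1 i, q.2 i) = (p.1 (ordS j), letter_inv (p.2 j)).
Proof.
have /mapP[j _ ij] := sub (step_edge_in q i); exists j => //.
by apply: edge_darts_cases; rewrite -ij; have [] := edge_darts_step q i.
Qed.

Lemma follow_step i j : q.1 i = p.1 j -> q.2 i = p.2 j ->
  q.1 (ordS i) = p.1 (ordS j) /\ q.2 (ordS i) = p.2 (ordS j).
Proof.
move=> e1 e2.
have S1 : q.1 (ordS i) = p.1 (ordS j).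
  have [t it [[f1 f2]|[f1 f2]]] := dart_in i.
    have jt : j = t by apply: p_inj; rewrite -e1.
    move: it; rewrite -{t f1 f2}jt /step_edge e2 e1.
    by case: ifP => _ [].
  have jt : j = ordS t by apply: p_inj; rewrite -e1.
  by case: (@p_red t); rewrite -jt -e2 f2 letter_invK.
split=> //; have [t it [[f1 f2]|[f1 f2]]] := dart_in (ordS i).
  by rewrite f2; congr (p.2 _); apply: p_inj; rewrite -f1.
have jt : j = t by apply/ordS_inj/p_inj; rewrite -f1.
by case: (@q_red i); rewrite f2 letter_invK -jt.
Qed.

Lemma follow_iter t :
  q.1 (iter t (@ordS _) ord0) = p.1 (iter t (@ordS _) ord0) /\
  q.2 (iter t (@ordS _) ord0) = p.2 (iter t (@ordS _) ord0).
Proof.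
elim: t => [|t [e1 e2]] /=; last exact: follow_step.
by case: first.
Qed.

Lemma follow_mod s t : s = t %[mod m'.+1] <-> s = t %[mod m.+1].
Proof.
have it0 k : iter s (@ordS k.+1) ord0 = iter t (@ordS k.+1) ord0 <->
    s = t %[mod k.+1].
  split=> [/(congr1 val)|st]; first by rewrite /= !iter_ordS !add0n.
  by apply: val_inj; rewrite /= !iter_ordS !add0n.
split=> /it0 H; apply/it0.
  apply: p_inj; have [<- _] := follow_iter s; have [<- _] := follow_iter t.
  by rewrite H.
apply: q_inj; have [-> _] := follow_iter s; have [-> _] := follow_iter t.
by rewrite H.
Qed.

Lemma sub_length : m' = m.
Proof.
apply/eqP; rewrite -eqSS eqn_dvd; apply/andP; split.
  apply/eqP; rewrite -[RHS](mod0n m'.+1); apply/follow_mod.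
  by rewrite modnn mod0n.
apply/eqP; rewrite -[RHS](mod0n m.+1); apply/follow_mod.
by rewrite modnn mod0n.
Qed.

End SubCycle.

Lemma cycle_eq d n r (a b : cycle_upto d n r) :
  {subset walk_edges (rep (tagged b)) <= walk_edges (rep (tagged a))} -> b = a.
Proof.
case: a b => i a [j b] /= sub.
set p := rep a in sub; set q := rep b in sub.
have pa : p \in val a := rep_in a; have qb : q \in val b := rep_in b.
have /mapP[t _ e0] := sub _ (step_edge_in q ord0).
have [x0 _] := edge_darts_step q ord0; rewrite e0 in x0.
have [p' p'a fp'] := class_first_dart pa x0.
have sub' : {subset walk_edges q <= walk_edges p'}.
  by move=> e /sub; exact: (walk_edges_class p'a pa).
have pc := class_cycle p'a; have qc := class_cycle qb.
have first : first_dart q = first_dart p' by rewrite fp'.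
have ij : j = i by apply: val_inj => /=; exact: sub_length pc qc first sub'.
subst j; suff qp : q = p' by rewrite (class_inj qb p'a)// -qp same_cycle_refl.
have F (s : 'I_i.+1) := follow_iter pc qc first sub' s.
rewrite [q]surjective_pairing [p']surjective_pairing; congr pair; apply/ffunP => s.
  by have [] := F s; rewrite !iter_ordS0.
by have [_] := F s; rewrite !iter_ordS0.
Qed.

(** * Cycles created or destroyed by the coupling *)

Section Touch.
Variables (R : realFieldType) (d n m : nat).
Implicit Types (E : seq (edge d n)) (b : labeled_cycle d n m.+1).

(** Sharing the tail or the head of an edge of [E], with the same label, is the
    only way for a cycle to be destroyed by [couple E]. *)
Definition touches E b := has (fun f => ~~ all (noclash f) E) (walk_edges (rep b)).
Definition meets E b := has (mem E) (walk_edges (rep b)).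
Definition inside E b := all (mem E) (walk_edges (rep b)).

Lemma class_count_ge1 E0 D b (y : walk d n m.+1) :
  y \in val b -> first_dart y \in D -> step_edge y ord_max \notin E0 ->
  1 <= \sum_(q in val b)
     (count_mem (first_dart q) D)%:R * (step_edge q ord_max \notin E0)%:R :> R.
Proof.
move=> yb yD yE; rewrite (bigD1 y)//= yE mulr1 -[leLHS]addr0 lerD//.
  by rewrite ler1n -has_count has_pred1.
by apply: sumr_ge0 => q _; rewrite mulr_ge0.
Qed.

Lemma mem_darts E e x : e \in E -> x \in edge_darts e -> x \in darts E.
Proof. by move=> eE xe; apply/flattenP; exists (edge_darts e) => //; exact: map_f. Qed.

(** A shared tail or head, together with its label, is a dart of [E] along which
    some representative of [b] starts. *)
Lemma touch_count E b : (touches E b)%:R <= \sum_(q in val b)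
  (count_mem (first_dart q) (darts E))%:R * (step_edge q ord_max \notin [::])%:R :> R.
Proof.
have [/hasP[f /mapP[j _ ->] /allPn[e eE fe]]|_] := boolP (touches E b); last first.
  by apply: sumr_ge0 => q _; rewrite mulr_ge0.
have [x xf xe] : exists2 x, x \in edge_darts (step_edge (rep b) j) & x \in edge_darts e.
  move: fe; rewrite /noclash negb_imply negb_and !negbK => /andP[/eqP l].
  rewrite /edge_darts -l => /orP[/eqP h|/eqP h].
    by exists (e.1.2, (e.1.1, false)); rewrite ?l !inE ?h -?l eqxx.
  by exists (e.2, (e.1.1, true)); rewrite ?l !inE ?h -?l eqxx ?orbT.
have [y yb fy] := class_first_dart (rep_in b) xf.
by apply: class_count_ge1 yb _ _ => //; rewrite fy; exact: mem_darts xe.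
Qed.

(** Going round [b], there is a place where it leaves the complement of [E] to
    enter [E]; the representative that starts there has its first edge in [E]
    and its last edge outside. *)
Lemma meet_count E b : (meets E b && ~~ inside E b)%:R <= \sum_(q in val b)
  (count_mem (first_dart q) (darts E))%:R * (step_edge q ord_max \notin E)%:R :> R.
Proof.
case: (boolP (_ && _)) => [|_]; last first.
  by apply: sumr_ge0 => q _; rewrite mulr_ge0.
case/andP => /hasP[_ /mapP[i _ ->] iE] /allPn[_ /mapP[j _ ->] jE].
have [t tE tE'] := cyclic_switch (A := fun i => step_edge (rep b) i \in E) iE jE.
have := @class_count_ge1 E (darts E) b _ (class_rotate t (rep_in b)).
rewrite first_dart_rotate last_edge_rotate; apply => //.
by apply: mem_darts tE _; have [] := edge_darts_step (rep b) t.
Qed.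

Definition label_darts E : seq ('I_n * letter d) :=
  [seq (us.1, (e.1.1, us.2)) | e : edge d n <- E, us <- enum {: 'I_n * bool}].

Lemma size_label_darts E : size (label_darts E) = (size E * (2 * n))%N.
Proof. by rewrite size_allpairs -cardE card_prod card_ord card_bool (mulnC n). Qed.

Lemma count_label_darts E x :
  (count (fun e => e.1.1 == x.2.1) E <= count_mem x (label_darts E))%N.
Proof.
rewrite /label_darts; elim: E => //= e E IH; rewrite count_cat leq_add//.
case: eqP => //= ex; rewrite -has_count has_pred1; apply/mapP.
exists (x.1, x.2.2); first by rewrite mem_enum.
by rewrite /= ex; case: x {IH ex} => ? [].
Qed.

(** Counts the pairs of equally labelled edges of [b] and [E], with [b] rotated to
    start along the first one.  Prescribing the label of the first step, instead
    of nothing, leaves [2 n] darts rather than [2 d n], and this saves the factor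
    that turns [(2 d - 1) ^ (2 r)] into [(2 d - 1) ^ (2 r - 1)]. *)
Lemma label_count E b : ~~ touches E b ->
  \sum_(f <- walk_edges (rep b)) (count (fun e => e.1.1 == f.1.1) E)%:R <=
  \sum_(q in val b)
    (count_mem (first_dart q) (label_darts E))%:R *
    (step_edge q ord_max \notin E)%:R :> R.
Proof.
move=> bE; rewrite big_map big_enum/=.
pose h (x : 'I_n * letter d) : R := (count (fun e => e.1.1 == x.2.1) E)%:R.
rewrite (eq_bigr (fun j => h ((rep b).1 j, (rep b).2 j))) => [|j _]; last first.
  by rewrite step_edge_label.
apply: (le_trans (sum_rotations _ (rep_in b))) => // .
apply: ler_sum => q qb; rewrite (_ : _ \notin _) ?mulr1 ?ler_nat ?count_label_darts//.
apply: contra bE => qE; apply/hasP; exists (step_edge q ord_max).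
  by apply: (walk_edges_class (rep_in b) qb); rewrite step_edge_in.
by apply/allPn; exists (step_edge q ord_max) => //; rewrite /noclash !eqxx.
Qed.

End Touch.

Section PairBound.
Variables (R : realFieldType) (d n m : nat).
Implicit Types (E : seq (edge d n)) (b : labeled_cycle d n m.+1).

(** If [b] touches [E], it is in one of the two graphs with at most the sum of the
    two probabilities, and in the coupled graph only if it shares an edge with
    [E].  Otherwise the coupling never destroys [b], and the probability that it
    creates [b] is a difference of probabilities, small by near independence. *)
Lemma pair_bound E b r : pairwise (@noclash d n) E -> ~~ inside E b -> (m < r < n)%N ->
  Pr_edges R E * mean (fun g => (contains (couple E g) b != contains g b)%:R) <=
  Pr_edges R E * ((touches E b)%:R * Pr R (fun g => contains g b)) +
  (meets E b && ~~ inside E b)%:R * Pr R (fun g => all (holds g) E && contains g b) +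
  (~~ touches E b)%:R * (\sum_(f <- walk_edges (rep b))
     (count (fun e => e.1.1 == f.1.1) E)%:R) / (n - r)%:R
     * Pr R (fun g => all (holds g) E && contains g b).
Proof.
move=> pE bE /andP[mr rn]; rewrite (negbTE bE) andbT.
set q := rep b; have qb : q \in val b := rep_in b; have qc := class_cycle qb.
pose J := mean (fun g => (contains (couple E g) b)%:R) : R.
have PJ : Pr_edges R E * J = Pr R (fun g => all (holds g) E && contains g b).
  rewrite -[J]/(mean ((fun g : perms d n => (contains g b)%:R) \o couple E)).
  by rewrite -mean_couple//; apply: eq_mean => g; rewrite -natrM mulnb.
have cE (g : perms d n) : contains g b = all (holds g) (walk_edges q).
  by rewrite all_holds_walk_edges (containsE _ qb).
have [t|t] := boolP (touches E b).
  rewrite mul1r mul0r !mul0r addr0.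
  apply: (@le_trans _ _ (Pr_edges R E * Pr R (fun g => contains g b)
    + Pr_edges R E * J)).
    rewrite -mulrDr ler_wpM2l ?Pr_ge0// /J /Pr -meanD; apply: le_mean => g.
    by case: contains; case: contains; rewrite //= ?addr0 ?add0r// ler_wpDr.
  rewrite PJ lerD//; case: (boolP (meets E b)) => [_|mE]; first by rewrite mul1r.
  rewrite mul0r /Pr /mean big1 ?mul0r// => g _.
  case: (boolP (_ && _)) => //= /andP[/allP gE]; rewrite cE => /allP gq.
  have /hasP[f fq /allPn[e eE]] := t.
  rewrite (holds_noclash (gq _ fq) (gE _ eE))//.
  by apply: contraNneq mE => fe; apply/hasP; exists f => //=; rewrite fe.
have mono (g : perms d n) : contains g b -> contains (couple E g) b.
  rewrite !cE => /allP gq; apply/allP => f fq; apply: couple_keep; last exact: gq.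
  by have /hasPn/(_ _ fq) := t; rewrite negbK.
have -> : mean (fun g => (contains (couple E g) b != contains g b)%:R) =
    J - Pr R (fun g => contains g b).
  rewrite /J /Pr -meanB; apply: eq_mean => g.
  have := mono g; case: (contains g b) => [->//|_] /=; first by rewrite subrr.
  by case: contains; rewrite ?subr0.
rewrite mul0r mulr0 add0r mul1r mulrBr PJ.
have PC : Pr R (fun g => contains g b) = Pr_edges R (walk_edges q) by exact: eq_Pr.
have PEC : Pr R (fun g => all (holds g) E && contains g b) =
    Pr_edges R (walk_edges q ++ E).
  by apply: eq_Pr => g; rewrite all_cat andbC cE.
have FE f : f \in walk_edges q -> all (noclash f) E.
  by move=> fq; have /hasPn/(_ _ fq) := t; rewrite negbK.
have szr : (size (walk_edges q) <= r < n)%N by rewrite size_walk_edges mr.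
have := Pr_edges_cat_le R (pairwise_walk_edges qc) FE szr.
rewrite PC PEC -mulr_suml; set s := \sum_(_ <- _) _ => H.
have : 0 <= (meets E b)%:R * Pr_edges R (walk_edges q ++ E).
  by rewrite mulr_ge0// Pr_ge0.
rewrite [s / _ * _]mulrC; lra.
Qed.

Lemma level_bound E r : pairwise (@noclash d n) E -> (size E + m.+1 <= 2 * r)%N ->
  (m < r)%N -> (4 * r <= n)%N -> (0 < n)%N ->
  Pr_edges R E * \sum_(b : labeled_cycle d n m.+1 | ~~ inside E b)
     mean (fun g => (contains (couple E g) b != contains g b)%:R) <=
  16 * (size E)%:R * ((2 * d - 1) ^ m)%:R / n%:R * Pr_edges R E.
Proof.
move=> pE szE mr rn n0.
have mrn : (m < r < n)%N by lia.
rewrite mulr_sumr; apply: (@le_trans _ _ (\sum_(b : labeled_cycle d n m.+1)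
  (Pr_edges R E * ((touches E b)%:R * Pr R (fun g => contains g b)) +
  (meets E b && ~~ inside E b)%:R * Pr R (fun g => all (holds g) E && contains g b) +
  (~~ touches E b)%:R * (\sum_(f <- walk_edges (rep b))
     (count (fun e => e.1.1 == f.1.1) E)%:R) / (n - r)%:R
     * Pr R (fun g => all (holds g) E && contains g b)))).
  rewrite [leLHS]big_mkcond/=; apply: ler_sum => b _.
  case: (boolP (~~ inside E b)) => bE.
    by have := @pair_bound E b r pE bE mrn; rewrite bE.
  by rewrite !addr_ge0 ?mulr_ge0 ?Pr_ge0 ?invr_ge0 ?sumr_ge0.
rewrite !big_split/= -mulr_sumr.
have K0 : (size ([::] : seq (edge d n)) + m <= 2 * r)%N by rewrite add0n; lia.
have K1 : (size E + m <= 2 * r)%N by lia.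
have B := class_bound (c := fun b => (touches E b)%:R) K0 (touch_count R E).
have A := class_bound (c := fun b => (meets E b && ~~ inside E b)%:R) K1
  (meet_count R E).
have C : forall b, (~~ touches E b)%:R * (\sum_(f <- walk_edges (rep b))
     (count (fun e => e.1.1 == f.1.1) E)%:R) <= \sum_(q in val b)
    (count_mem (first_dart q) (label_darts E))%:R *
    (step_edge q ord_max \notin E)%:R :> R.
  move=> b; have [t|t] := boolP (touches E b); last first.
    by rewrite mul1r; exact: label_count.
  by rewrite mul0r sumr_ge0// => q _; rewrite mulr_ge0.
have {}C := class_bound K1 C.
under [X in _ + X <= _]eq_bigr do rewrite -mulrA mulrCA.
rewrite -mulr_sumr.
(* [2 r] edges at most are ever prescribed, and [n - 2 r >= n / 2]. *)
move: A B C; rewrite Pr_edges_nil !size_darts size_label_darts /=.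
rewrite !natrM.
set N := n%:R; set X := (n - 2 * r)%:R; set Y := (n - r)%:R.
set SA := \sum_b (meets _ _ && _)%:R * _; set SB := \sum_b (touches _ _)%:R * _.
set SC := \sum_b (~~ touches _ _)%:R * _ * _.
set P := Pr_edges R E; set B := ((2 * d - 1) ^ m)%:R; set s := (size E)%:R.
have N0 : 0 < N by rewrite ltr0n.
have P0 : 0 <= P by exact: Pr_ge0.
have [B0 s0] : 0 <= B /\ 0 <= s by [].
have half k : (2 * k <= n)%N -> 0 < (n - k)%:R :> R /\ (n - k)%:R^-1 <= 2 / N.
  move=> kn; have kN : N / 2 <= (n - k)%:R.
    by rewrite ler_pdivrMr// -natrM ler_nat; lia.
  have N2 : 0 < N / 2 by rewrite divr_gt0.
  split; first exact: lt_le_trans kN.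
  by rewrite -[2 / N]invf_div lef_pV2// posrE (lt_le_trans _ kN).
have [X0 XN] : 0 < X /\ X^-1 <= 2 / N by apply: half; lia.
have [Y0 YN] : 0 < Y /\ Y^-1 <= 2 / N by apply: half; lia.
have bnd S u : X * S <= u -> 0 <= u -> S <= u * (2 / N).
  move=> XS u0; move: XS; rewrite mulrC -ler_pdivlMr// => /le_trans; apply.
  by rewrite ler_wpM2l.
move=> /bnd A /bnd B' /bnd C.
have {}A := A (mulr_ge0 (mulr_ge0 (mulr_ge0 (ler0n _ _) s0) B0) P0).
have {}B' := B' (mulr_ge0 (mulr_ge0 (mulr_ge0 (ler0n _ _) s0) B0) ler01).
have {}C := C (mulr_ge0 (mulr_ge0 (mulr_ge0 s0 (mulr_ge0 (ler0n _ _) (ltW N0))) B0) P0).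
have Yi0 : 0 <= Y^-1 by rewrite invr_ge0 ltW.
apply: le_trans (lerD (lerD (ler_wpM2l P0 B') A) (ler_wpM2l Yi0 C)) _.
have -> : Y^-1 * (s * (2 * N) * B * P * (2 / N)) = Y^-1 * (4 * (s * B * P)).
  by field; apply/andP; split; [exact: lt0r_neq0 Y0|exact: lt0r_neq0 N0].
have : Y^-1 * (4 * (s * B * P)) <= 2 / N * (4 * (s * B * P)).
  apply: ler_wpM2r YN; exact: (mulr_ge0 (ler0n _ 4) (mulr_ge0 (mulr_ge0 s0 B0) P0)).
lra.
Qed.

End PairBound.

(** * Sums over all cycles *)

Lemma sum_geometric_le b r : (2 <= b)%N -> (\sum_(i < r.+1) b ^ i <= 2 * b ^ r)%N.
Proof.
move=> b2; elim: r => [|r IH]; first by rewrite big_ord_recl big_ord0.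
rewrite big_ord_recr/=; apply: leq_trans (leq_add IH (leqnn _)) _.
by rewrite expnS; nia.
Qed.

Section Level.
Variables (R : realFieldType) (d n m : nat).

Lemma class_size (a : labeled_cycle d n m.+1) : (m.+1 <= #|val a|)%N.
Proof.
have := @sum_rotations d n m int (fun=> 1) a (rep a) (fun=> ler01) (rep_in a).
by rewrite !sumr_const card_ord ler_nat.
Qed.

Lemma card_cycles : (m.+1 * #|{: labeled_cycle d n m.+1}| <=
  n ^_ m.+1 * (2 * d * (2 * d - 1) ^ m))%N.
Proof.
have words : (#|[set w : {ffun 'I_m.+1 -> letter d} | cyclically_reduced w]| <=
    2 * d * (2 * d - 1) ^ m)%N.
  rewrite -sum1_card.
  rewrite (partition_big (fun w : {ffun 'I_m.+1 -> letter d} => w ord0) predT)//=.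
  rewrite -[X in (_ <= X * _)%N]card_letter -sum_nat_const; apply: leq_sum => x _.
  apply: leq_trans (card_reduced m x); rewrite -sum1_card.
  by apply: eq_leq; apply: eq_bigl => w; rewrite !inE.
have := card_inj_ffuns ('I_m.+1) ('I_n); rewrite !card_ord => <-.
apply: leq_trans (leq_mul (leqnn _) words); rewrite -cardsX.
rewrite mulnC -sum_nat_const.
apply: (@leq_trans (\sum_(a : labeled_cycle d n m.+1) \sum_(q in val a) 1)).
  by apply: leq_sum => a _; rewrite sum1_card class_size.
have := @sum_class d n m nat (fun=> 1%N); rewrite /GRing.add /= => <-.
rewrite sum1_card; apply/subset_leq_card/fintype.subsetP => -[s w].
by rewrite !inE !unfold_in.
Qed.

(** The representatives of a cycle of length [m + 1] start along at least [m + 1] of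
    the [2 d n] darts. *)
Lemma mean_cycles r : (m < r)%N -> (4 * r <= n)%N ->
  \sum_(a : labeled_cycle d n m.+1) m.+1%:R * Pr_edges R (walk_edges (rep a)) <=
  4 * d%:R * ((2 * d - 1) ^ m)%:R.
Proof.
move=> mr rn.
have K0 : (size ([::] : seq (edge d n)) + m <= 2 * r)%N by rewrite add0n; lia.
have := @class_bound R d n m [::] (enum {: 'I_n * letter d}) _ (fun=> m.+1%:R) K0.
rewrite Pr_edges_nil mulr1 -cardE card_prod card_ord card_letter.
move=> H; have {}H := H _.
have c (b : labeled_cycle d n m.+1) : m.+1%:R <= \sum_(q in val b)
     (count_mem (first_dart q) (enum {: 'I_n * letter d}))%:R *
     (step_edge q ord_max \notin [::])%:R :> R.
  apply: (@le_trans _ _ (\sum_(q in val b) 1)).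
    by rewrite sumr_const ler_nat; exact: class_size.
  apply: ler_sum => q _; rewrite mulr1 ler1n -has_count has_pred1 mem_enum//.
have {}H := H c.
have -> : \sum_(a : labeled_cycle d n m.+1) m.+1%:R * Pr_edges R (walk_edges (rep a)) =
    \sum_(b : labeled_cycle d n m.+1) m.+1%:R *
      Pr R (fun g => all (holds g) [::] && contains g b).
  apply: eq_bigr => a _; congr (_ * _); apply: eq_Pr => g.
  by rewrite all_holds_walk_edges (containsE _ (rep_in a)).
set S := \sum_b _ in H *.
have S0 : 0 <= S by apply: sumr_ge0 => b _; rewrite mulr_ge0// Pr_ge0.
have n2 : n%:R / 2 <= (n - 2 * r)%:R :> R.
  by rewrite ler_pdivrMr// -natrM ler_nat; lia.
have n0 : 0 < n%:R / 2 :> R by rewrite divr_gt0// ltr0n; lia.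
rewrite -(ler_pM2l n0); apply: le_trans (ler_wpM2r S0 n2) _.
apply: le_trans H _; rewrite !natrM; lra.
Qed.

End Level.

(** The chance that [k] independent uniform points are distinct. *)
Lemma ffact_ge (R : realFieldType) n k : (k <= n)%N -> (0 < n)%N ->
  1 - (k ^ 2)%:R / n%:R <= (n ^_ k)%:R / (n ^ k)%:R :> R.
Proof.
move=> + n0; have N0 : 0 < n%:R :> R by rewrite ltr0n.
elim: k => [|k IH] kn; first by rewrite ffactn0 expn0 mul0r divr1 subr0.
rewrite ffactnSr (expnSr n k) (natrM _ (n ^_ k)) (natrM _ (n ^ k)) -mulf_div.
rewrite natrB ?(ltnW kn)//.
have {}IH := IH (ltnW kn).
rewrite mulrBl divff ?gt_eqF//.
have k0 : 0 <= k%:R / n%:R :> R by rewrite divr_ge0.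
have k1 : 0 <= 1 - k%:R / n%:R :> R.
  by rewrite subr_ge0 ler_pdivrMr// mul1r ler_nat ltnW.
apply: le_trans (ler_wpM2r k1 IH).
have -> : (k.+1 ^ 2)%:R / n%:R = (k ^ 2)%:R / n%:R + 2 * (k%:R / n%:R) + n%:R^-1 :> R.
  by rewrite !natrX -natr1; field; rewrite gt_eqF.
have : 0 <= n%:R^-1 :> R by rewrite invr_ge0 ltW.
have : 0 <= (k ^ 2)%:R / n%:R :> R by rewrite divr_ge0.
set t := k%:R / n%:R in k0 k1 *; set u := (k ^ 2)%:R / _; set v := n%:R^-1; nra.
Qed.

Section Totals.
Variables (R : realFieldType) (d n r : nat).
Hypotheses (d2 : (2 <= d)%N) (n1 : (1 <= n)%N) (rn : (4 * r.+1 <= n)%N).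

Local Notation I := (cycle_upto d n r.+1).
Local Notation b := (2 * d - 1)%N.

Definition cyc_edges (a : I) : seq (edge d n) := walk_edges (rep (tagged a)).
Definition cyc_prob (a : I) : R := Pr_edges R (cyc_edges a).
Definition cyc_rate (a : I) : R := (n ^_ (cycle_length a))%:R^-1.

Lemma size_cyc_edges (a : I) : size (cyc_edges a) = cycle_length a.
Proof. exact: size_walk_edges. Qed.

Lemma pairwise_cyc_edges a : pairwise (@noclash d n) (cyc_edges a).
Proof. exact: pairwise_walk_edges (class_cycle (rep_in _)). Qed.

Lemma cycle_length_le (a : I) : (cycle_length a <= r.+1)%N.
Proof. exact: ltn_ord. Qed.

Lemma sum_upto (F : forall i : 'I_r.+1, labeled_cycle d n i.+1 -> R) :
  \sum_(a : I) F (tag a) (tagged a) =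
  \sum_(i < r.+1) \sum_(x : labeled_cycle d n i.+1) F i x.
Proof. by rewrite sig_big_dep. Qed.

(** For a cycle [a] of length [k] the expected change under the coupling is of order
    [k (2 d - 1) ^ r / n], and the sum of [k] times the probability of [a] over
    all [a] is of order [(2 d - 1) ^ (r + 1)]. *)
Lemma sum_change :
  \sum_(a : I) cyc_prob a * \sum_(c : I | c != a)
     mean (fun g => (contains (couple (cyc_edges a) g) (tagged c)
                     != contains g (tagged c))%:R) <=
  256 * (b ^ (2 * r).+1)%:R / n%:R.
Proof.
have b2 : (2 <= b)%N by lia.
have N0 : 0 < n%:R :> R by rewrite ltr0n.
have geo : \sum_(i < r.+1) (b ^ i)%:R <= 2 * (b ^ r)%:R :> R.
  by rewrite -natr_sum -natrM ler_nat sum_geometric_le.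
apply: (@le_trans _ _ (\sum_(a : I)
   32 * (b ^ r)%:R / n%:R *
   ((tag a).+1%:R * Pr_edges R (walk_edges (rep (tagged a)))))).
  apply: ler_sum => a _; set E := cyc_edges a.
  have P0 : 0 <= cyc_prob a by exact: Pr_ge0.
  apply: (@le_trans _ _ (\sum_(i < r.+1)
     (16 * (size E)%:R / n%:R * Pr_edges R E) * (b ^ i)%:R)).
    pose F i (x : labeled_cycle d n i.+1) : R :=
      mean (fun g => (contains (couple E g) x != contains g x)%:R).
    apply: (@le_trans _ _ (cyc_prob a *
      \sum_(c : I | ~~ inside E (tagged c)) F _ (tagged c))).
      rewrite ler_wpM2l// [leLHS]big_mkcond [leRHS]big_mkcond/=.
      apply: ler_sum => c _; have F0 : 0 <= F _ (tagged c) by apply: mean_ge0.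
      case: eqVneq => [_|ca] /=; first by case: ifP.
      rewrite ifT//; apply: contra ca => /allP/cycle_eq ->; exact: eqxx.
    have := sig_big_dep (fun=> true) (fun (i : 'I_r.+1) x => ~~ inside E x)
      (fun i x => F i x) (op := +%R) (idx := 0).
    move=> /= <-; rewrite mulr_sumr; apply: ler_sum => i _.
    have := @level_bound R d n i E r.+1 (pairwise_cyc_edges a) _ (ltn_ord i) rn n1.
    rewrite size_cyc_edges => H; apply: le_trans (H _) _.
      by have := cycle_length_le a; have := ltn_ord i; lia.
    by rewrite le_eqVlt; apply/orP; left; apply/eqP; ring.
  rewrite -mulr_sumr; apply: le_trans (ler_wpM2l _ geo) _.
    by apply: mulr_ge0; [rewrite !mulr_ge0 ?invr_ge0|exact: Pr_ge0].
  rewrite size_cyc_edges le_eqVlt; apply/orP; left; apply/eqP.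
  by rewrite /E /cyc_edges /cycle_length; move: (tag a).+1%:R => k; ring.
rewrite -mulr_sumr.
rewrite (sum_upto (fun i x => i.+1%:R * Pr_edges R (walk_edges (rep x)))).
have c0 : 0 <= 32 * (b ^ r)%:R / n%:R :> R by rewrite !mulr_ge0 ?invr_ge0.
apply: (@le_trans _ _ (32 * (b ^ r)%:R / n%:R * \sum_(i < r.+1) 4 * d%:R * (b ^ i)%:R)).
  rewrite ler_wpM2l//; apply: ler_sum => i _.
  exact: mean_cycles (ltn_ord i) rn.
rewrite -mulr_sumr; apply: (@le_trans _ _
  (32 * (b ^ r)%:R / n%:R * (4 * b%:R * (2 * (b ^ r)%:R)))).
  rewrite ler_wpM2l// ler_pM ?mulr_ge0 ?sumr_ge0// ler_wpM2l// ler_nat; lia.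
rewrite le_eqVlt; apply/orP; left; apply/eqP.
rewrite (mul2n r) -addnn expnS expnD !natrM; field; exact: lt0r_neq0.
Qed.

Lemma rate_gt0 a : 0 < cyc_rate a.
Proof.
rewrite invr_gt0 ltr0n ffact_gt0; have := cycle_length_le a; lia.
Qed.

Lemma prob_le_rate a : cyc_prob a <= cyc_rate a.
Proof.
have := Pr_edges_le R (pairwise_cyc_edges a); rewrite size_cyc_edges => H.
have := rate_gt0 a; rewrite invr_gt0 => r0.
by rewrite /cyc_rate -[leRHS]mul1r ler_pdivlMr// mulrC.
Qed.

Lemma geo_rate : \sum_(i < r.+1) 2 * (b ^ i.+1)%:R <= 4 * (b ^ r.+1)%:R :> R.
Proof.
rewrite -mulr_sumr.
rewrite (eq_bigr (fun i : 'I_r.+1 => b%:R * (b ^ i)%:R)) => [|i _]; last first.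
  by rewrite expnS natrM.
rewrite -mulr_sumr expnS natrM.
have geo : \sum_(i < r.+1) (b ^ i)%:R <= 2 * (b ^ r)%:R :> R.
  by rewrite -natr_sum -natrM ler_nat sum_geometric_le//; lia.
have := ler_wpM2l (ler0n R b) geo; lra.
Qed.

Lemma card_level (i : 'I_r.+1) : i.+1%:R * #|{: labeled_cycle d n i.+1}|%:R <=
  (n ^_ i.+1)%:R * (2 * (b ^ i.+1)%:R) :> R.
Proof.
rewrite -!natrM ler_nat; apply: leq_trans (card_cycles _ _ _) _.
rewrite leq_mul2l -mulnA leq_mul2l/= expnS leq_mul2r.
by apply/orP; right; apply/orP; right; lia.
Qed.

Lemma level_ffact (i : 'I_r.+1) :
  0 < (n ^_ i.+1)%:R :> R /\ n%:R <= (n ^_ i.+1)%:R :> R.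
Proof.
have ir := ltn_ord i; split; first by rewrite ltr0n ffact_gt0; lia.
rewrite ler_nat ffactnS leq_pmulr// ffact_gt0; lia.
Qed.

(** The number [r + 1] of lengths is absorbed by [r] powers of [2 d - 1]. *)
Lemma pow_shift : (b ^ r.+1 * r.+1 <= b ^ (2 * r).+1)%N.
Proof.
rewrite (mul2n r) -addnn -addSn expnD leq_mul2l; apply/orP; right.
by rewrite ltn_expl//; lia.
Qed.

Lemma sum_rate_sqr : \sum_(a : I) cyc_rate a ^+ 2 <= 4 * (b ^ (2 * r).+1)%:R / n%:R.
Proof.
have N0 : 0 < n%:R :> R by rewrite ltr0n.
apply: (@le_trans _ _ (\sum_(i < r.+1) 2 * (b ^ i.+1)%:R / n%:R)); last first.
  rewrite -mulr_suml ler_wpM2r ?invr_ge0//; apply: le_trans geo_rate _.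
  rewrite ler_wpM2l// ler_nat; apply: leq_trans pow_shift.
  by rewrite leq_pmulr.
rewrite (sum_upto (fun i x => (n ^_ i.+1)%:R^-1 ^+ 2)).
apply: ler_sum => i _; rewrite sumr_const -[leLHS]mulr_natl.
have [f0 fn] := level_ffact i; have L := card_level i.
set f := (n ^_ i.+1)%:R in f0 fn L *; set B := (b ^ i.+1)%:R in L *.
set M := #|_|%:R in L *.
have {}L : M <= f * (2 * B) by apply: le_trans L; rewrite ler_peMl// ler1n.
apply: (@le_trans _ _ (f * (2 * B) * f^-1 ^+ 2)).
  by rewrite ler_wpM2r// exprn_ge0// invr_ge0 ltW.
have -> : f * (2 * B) * f^-1 ^+ 2 = 2 * B * f^-1 by field; exact: lt0r_neq0.
by apply: ler_wpM2l; [rewrite mulr_ge0|rewrite lef_pV2].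
Qed.

(** The probability of a cycle of length [k] depends on how its labels repeat,
    but always lies between [1 / n ^ k] and [1 / [n]_k], which differ by a factor
    [1 + O(k ^ 2 / n)]. *)
Lemma sum_rate_sub : \sum_(a : I) (cyc_rate a - cyc_prob a) <=
  4 * (b ^ (2 * r).+1)%:R / n%:R.
Proof.
have N0 : 0 < n%:R :> R by rewrite ltr0n.
apply: (@le_trans _ _
  (\sum_(i < r.+1) 2 * (b ^ i.+1)%:R * (r.+1%:R / n%:R))); last first.
  rewrite -mulr_suml mulrA ler_wpM2r ?invr_ge0//.
  apply: le_trans (ler_wpM2r (ler0n _ _) geo_rate) _.
  by rewrite -mulrA ler_wpM2l// -natrM ler_nat pow_shift.
rewrite (sum_upto (fun i x => (n ^_ i.+1)%:R^-1 - Pr_edges R (walk_edges (rep x)))).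
apply: ler_sum => i _.
have [f0 fn] := level_ffact i; have L := card_level i.
have G := @ffact_ge R n i.+1.
have in' : (i < n)%N by have := ltn_ord i; lia.
have {}G := G in' n1.
have g0 : 0 < (n ^ i.+1)%:R :> R by rewrite ltr0n expn_gt0 n1.
apply: (@le_trans _ _ (\sum_(x : labeled_cycle d n i.+1)
    ((n ^_ i.+1)%:R^-1 - (n ^ i.+1)%:R^-1))).
  apply: ler_sum => x _; rewrite lerD2l lerN2.
  have := Pr_edges_ge R (pairwise_walk_edges (class_cycle (rep_in x))).
  rewrite size_walk_edges.
  by rewrite mulrC -ler_pdivrMr// mul1r.
rewrite sumr_const -[leLHS]mulr_natl.
have kr : i.+1%:R <= r.+1%:R :> R by rewrite ler_nat.
have k0 : 0 < i.+1%:R :> R by rewrite ltr0n.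
rewrite natrX in G.
set f := (n ^_ i.+1)%:R in f0 fn L G *; set B := (b ^ i.+1)%:R in L *.
set M := #|_|%:R in L *; set g := (n ^ i.+1)%:R in g0 G *.
set k := i.+1%:R in L G kr k0 *.
have fg : f^-1 - g^-1 <= f^-1 * (k ^+ 2 / n%:R).
  have -> : f^-1 - g^-1 = f^-1 * (1 - f / g).
    by field; rewrite !lt0r_neq0.
  by rewrite ler_wpM2l ?invr_ge0 ?(ltW f0)//; lra.
have M0 : 0 <= M by [].
apply: le_trans (ler_wpM2l M0 fg) _.
have -> : M * (f^-1 * (k ^+ 2 / n%:R)) = (k * M) * (f^-1 * (k / n%:R)) by ring.
have fk0 : 0 <= f^-1 * (k / n%:R) by rewrite mulr_ge0 ?divr_ge0 ?invr_ge0 ?ltW.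
apply: le_trans (ler_wpM2r fk0 L) _.
have -> : f * (2 * B) * (f^-1 * (k / n%:R)) = 2 * B * (k / n%:R).
  by field; rewrite !lt0r_neq0.
by rewrite ler_wpM2l// ?mulr_ge0// ler_wpM2r// invr_ge0 ltW.
Qed.

End Totals.

(** * Distance to a product of weights on bits *)

Section Combine.
Variables (R : realFieldType) (d n r : nat).
Hypotheses (d2 : (2 <= d)%N) (n1 : (1 <= n)%N) (rn : (4 * r.+1 <= n)%N).
Local Notation I := (cycle_upto d n r.+1).
Local Notation b := (2 * d - 1)%N.

Definition contained_cycles (g : perms d n) : {ffun I -> bool} :=
  [ffun a => contains g (tagged a)].

(** The indicators of the cycles, under uniform permutations, against independent
    bits with approximately Poisson weights. *)
Lemma product_approx (q : I -> bool -> R) (f : {ffun I -> bool} -> R) :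
  (forall a e, 0 <= q a e) -> (forall a, q a false + q a true <= 1) ->
  (forall a, `|cyc_rate R a - q a true| <= cyc_rate R a ^+ 2) ->
  (forall a, `|1 - cyc_rate R a - q a false| <= cyc_rate R a ^+ 2) ->
  (forall x, `|f x| <= 1) ->
  `|mean (f \o contained_cycles) - \sum_x f x * \prod_a q a (x a)| <=
  1040 * (b ^ (2 * r).+1)%:R / n%:R.
Proof.
move=> q0 q1 qt qf f1.
have cpl a F : mean (fun g => (contained_cycles g a)%:R * F g) =
    cyc_prob R a * mean (F \o couple (cyc_edges a)).
  rewrite -mean_couple ?pairwise_cyc_edges//; apply: eq_mean => g.
  by rewrite ffunE (containsE _ (rep_in _)) -all_holds_walk_edges.
have p0 (a : I) : 0 <= cyc_prob R a by exact: Pr_ge0.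
have := lindeberg (C := fun a => couple (cyc_edges a)) (card_perms_gt0 d n)
  cpl p0 q0 q1 f1.
move/le_trans; apply.
apply: (@le_trans _ _ (\sum_(a : I) (4 * (cyc_prob R a * \sum_(c : I | c != a)
     mean (fun g => (contains (couple (cyc_edges a) g) (tagged c)
                     != contains g (tagged c))%:R)) +
   2 * (cyc_rate R a - cyc_prob R a) + 2 * cyc_rate R a ^+ 2))).
  apply: ler_sum => a _.
  under [X in 4 * (_ * X)]eq_bigr => c _ do
    under [X in mean X]eq_fun => g do rewrite !ffunE.
  set A := 4 * _.
  have pr := prob_le_rate R d2 n1 rn a.
  have : `|cyc_prob R a - q a true| <=
      (cyc_rate R a - cyc_prob R a) + cyc_rate R a ^+ 2.
    have := qt a; rewrite !ler_norml; lra.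
  have : `|1 - cyc_prob R a - q a false| <=
      (cyc_rate R a - cyc_prob R a) + cyc_rate R a ^+ 2.
    have := qf a; rewrite !ler_norml; lra.
  lra.
rewrite !big_split/= -!mulr_sumr.
have := sum_change R d2 n1 rn; have := sum_rate_sqr R d2 n1 rn.
have := sum_rate_sub R d2 n1 rn.
set X := _ / n%:R; set Y := 256 * _ / _.
have -> : Y = 64 * X by rewrite /X /Y; field; rewrite pnatr_eq0 -lt0n.
have -> : 1040 * (b ^ (2 * r).+1)%:R / n%:R = 260 * X.
  by rewrite /X; field; rewrite pnatr_eq0 -lt0n.
by lra.
Qed.

End Combine.

Local Open Scope classical_set_scope.
Local Open Scope ring_scope.

(** * Poisson weights at 0 and 1 *)

Section PoissonPmf.
Variable R : realType.
Implicit Types l : R.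

Lemma expR_bounds l : 0 <= l -> 1 - l <= expR (- l) <= 1 - l + l ^+ 2.
Proof.
move=> l0; apply/andP; split; first exact: expR_ge1Dx.
rewrite expRN; have l1 : 0 < 1 + l by lra.
have e1 : 1 + l <= expR l := expR_ge1Dx l.
apply: (@le_trans _ _ (1 + l)^-1).
  by rewrite lef_pV2 ?posrE ?expR_gt0.
rewrite -[leLHS]mul1r ler_pdivrMr//.
have -> : (1 - l + l ^+ 2) * (1 + l) = 1 + l ^+ 3 by ring.
by rewrite lerDl exprn_ge0.
Qed.

Lemma poisson_pmf0 l : 0 < l -> poisson_pmf l 0 = expR (- l).
Proof. by move=> l0; rewrite /poisson_pmf l0 expr0 fact0 invr1 !mul1r. Qed.

Lemma poisson_pmf1 l : 0 < l -> poisson_pmf l 1 = l * expR (- l).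
Proof. by move=> l0; rewrite /poisson_pmf l0 expr1 (_ : 1`! = 1%N)// invr1 mulr1. Qed.

Lemma poisson_pmf0_dist l : 0 < l -> `|1 - l - poisson_pmf l 0| <= l ^+ 2.
Proof.
move=> l0; rewrite poisson_pmf0//; have /andP[] := expR_bounds (ltW l0).
by rewrite ler_norml => *; have := sqr_ge0 l; lra.
Qed.

Lemma poisson_pmf1_dist l : 0 < l -> `|l - poisson_pmf l 1| <= l ^+ 2.
Proof.
move=> l0; rewrite poisson_pmf1//; have /andP[e1 _] := expR_bounds (ltW l0).
have e2 : expR (- l) <= 1 by rewrite -expR0 ler_expR oppr_le0 ltW.
by rewrite ler_norml expr2; nra.
Qed.

Lemma poisson_pmf01_le1 l : 0 < l -> poisson_pmf l 0 + poisson_pmf l 1 <= 1.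
Proof.
move=> l0; rewrite poisson_pmf0// poisson_pmf1// expRN -[X in X + _]mul1r -mulrDl.
by rewrite ler_pdivrMr ?expR_gt0// mul1r expR_ge1Dx.
Qed.

End PoissonPmf.

(** * From random variables to finite averages *)

Section FiniteLaws.
Variables (R : realType) (dO : measure_display) (Omega : measurableType dO).
Variable P : probability Omega R.

Lemma measure_finite_disjoint (J : choiceType) (F : J -> set Omega) (s : seq J) :
  uniq s -> (forall j, measurable (F j)) ->
  (forall i j, F i `&` F j !=set0 -> i = j) ->
  P (\bigcup_(j in [set` s]) F j) = (\sum_(j <- s) P (F j))%E.
Proof.
move=> us mF dF; rewrite measure_fin_bigcup//; last by move=> i j _ _; exact: dF.
by rewrite -fsbig_seq.
Qed.

Lemma independent_atom (I : finType) d' (T' : measurableType d')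
    (X : I -> {RV P >-> T'}) (x : I -> T') (q : I -> R) :
  mutually_independent X -> (forall i, measurable [set x i]) ->
  (forall i, P (X i @^-1` [set x i]) = (q i)%:E) ->
  P [set w | forall i, X i w = x i] = (\prod_i q i)%:E.
Proof.
move=> indep mx qx; have := indep [set: I]%SET (fun i => [set x i]) mx.
rewrite (_ : (\prod_(i in _) _)%E = (\prod_i q i)%:E) => [<-|].
  congr (P _); apply/seteqP; split => w /= wx i; last by apply: wx; rewrite /= inE.
  by move=> _; exact: wx.
by rewrite -prodEFin; apply: eq_big => i; rewrite ?inE// => _; exact: qx.
Qed.

Lemma measurable_atom (I : finType) d' (T' : measurableType d')
    (X : I -> {RV P >-> T'}) (x : I -> T') :
  (forall i, measurable [set x i]) -> measurable [set w | forall i, X i w = x i].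
Proof.
move=> mx.
rewrite (_ : [set w | _] = \bigcap_(i in [set: I]) (X i @^-1` [set x i])).
  by apply: fin_bigcap_measurable => // i _; exact: measurable_funPTI.
by apply/seteqP; split => w /= wx i; [move=> _; exact: wx | exact: wx].
Qed.

End FiniteLaws.

Section PermLaw.
Variables (R : realType) (dO : measure_display) (Omega : measurableType dO).
Variables (P : probability Omega R) (d n : nat).
Variable pi : 'I_d -> {RV P >-> {perm 'I_n}}.
Hypotheses (unif : forall l, uniform_perm (pi l)) (indep : mutually_independent pi).

Definition joint (w : Omega) : perms d n := [ffun l => pi l w].

Lemma perm_law (S : pred (perms d n)) :
  P [set w | S (joint w)] = (Pr R S)%:E.
Proof.
have jointE g : [set w | joint w = g] = [set w | forall l, pi l w = g l].
  apply/seteqP; split => w /=; first by move=> <- l; rewrite ffunE.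
  by move=> wg; apply/ffunP => l; rewrite ffunE.
have atom g : P [set w | joint w = g] = (#|perms d n|%:R^-1)%:E.
  have qx l : P (pi l @^-1` [set g l]) = (n`!%:R^-1)%:E by exact: unif.
  rewrite jointE (independent_atom (q := fun=> n`!%:R^-1) indep _ qx)//.
  by rewrite prodr_const card_ffun !card_ord (card_Sn n) natrX exprVn.
have -> : [set w | S (joint w)] = \bigcup_(g in [set` enum S]) [set w | joint w = g].
  apply/seteqP; split => w /=.
    by move=> Sw; exists (joint w) => //=; rewrite mem_enum.
  by move=> [g /=]; rewrite mem_enum => Sg ->.
rewrite measure_finite_disjoint ?enum_uniq//.
- rewrite (eq_bigr (fun=> (#|perms d n|%:R^-1)%:E)) => [|g _]; last exact: atom.
  rewrite sumEFin big_enum/= /Pr /mean mulr_suml big_mkcond/=.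
  congr EFin; apply: eq_bigr => g _.
  by rewrite unfold_in; case: (S g); rewrite ?mul1r ?mul0r.
- by move=> g; rewrite jointE; exact: measurable_atom.
- by move=> g h [w [/= -> ->]].
Qed.

End PermLaw.

Section CountLaw.
Variables (R : realType) (dO : measure_display) (Omega : measurableType dO).
Variables (P : probability Omega R) (I : finType).
Variable Z : I -> {RV P >-> nat}.

Definition joint_count (w : Omega) : {ffun I -> nat} := [ffun a => Z a w].

(** It is enough to test the generators of the product sigma-algebra. *)
Lemma measurable_joint_count (A : set {ffun I -> nat}) :
  measurable A -> measurable (joint_count @^-1` A).
Proof.
pose G := [set A : set {ffun I -> nat} | measurable (joint_count @^-1` A)].
suff : ffun_measurable (T := nat) `<=` G by apply.
apply: smallest_sub.
  split; rewrite /G /=.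
  - by rewrite preimage_set0.
  - by move=> B mB; rewrite setTD preimage_setC; exact: measurableC.
  - by move=> F mF; rewrite preimage_bigcup; exact: bigcup_measurable.
move=> _ [a _ [B mB <-]]; rewrite /G /= setTI.
rewrite (_ : _ @^-1` _ = Z a @^-1` B); first exact: measurable_funPTI.
by apply/seteqP; split => w /=; rewrite ffunE.
Qed.

Definition of_bits (x : {ffun I -> bool}) : {ffun I -> nat} :=
  [ffun a => nat_of_bool (x a)].

Lemma of_bits_inj : injective of_bits.
Proof.
move=> x y /ffunP xy; apply/ffunP => a; have := xy a; rewrite !ffunE.
by case: (x a); case: (y a).
Qed.

Variable q : I -> bool -> R.
Hypothesis indep : mutually_independent Z.
Hypothesis qZ : forall a e, P (Z a @^-1` [set nat_of_bool e]) = (q a e)%:E.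

(** Counts larger than 1 are discarded, which is why this is only an inequality;
    applied to [A] and to its complement, it locates the probability of [A] up
    to the total mass missing from the bits. *)
Lemma count_law_ge (A : set {ffun I -> nat}) : measurable A ->
  ((\sum_x (of_bits x \in A)%:R * \prod_a q a (x a))%:E <= P (joint_count @^-1` A))%E.
Proof.
move=> mA.
have atomE (x : {ffun I -> bool}) : [set w | joint_count w = of_bits x] =
    [set w | forall a, Z a w = x a].
  apply/seteqP; split => w /=.
    by move=> /ffunP wx a; have := wx a; rewrite !ffunE.
  by move=> wx; apply/ffunP => a; rewrite !ffunE wx.
have matom (x : {ffun I -> bool}) : measurable [set w | joint_count w = of_bits x].
  by rewrite atomE; exact: measurable_atom.
pose s := enum (fun x : {ffun I -> bool} => of_bits x \in A).
have sub : \bigcup_(x in [set` s]) [set w | joint_count w = of_bits x] `<=`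
    joint_count @^-1` A.
  by move=> w [x /=]; rewrite mem_enum unfold_in => /set_mem + ->.
have mU : measurable (\bigcup_(x in [set` s]) [set w | joint_count w = of_bits x]).
  exact: fin_bigcup_measurable.
have mZ := measurable_joint_count mA.
have : (P (\bigcup_(x in [set` s]) [set w | joint_count w = of_bits x]) <=
    P (joint_count @^-1` A))%E by exact: le_measure (mem_set mU) (mem_set mZ) sub.
apply: le_trans.
rewrite measure_finite_disjoint ?enum_uniq//; last first.
  by move=> x y [w /= [-> /of_bits_inj]].
rewrite big_enum/= (eq_bigr (fun x : {ffun I -> bool} =>
    (\prod_a q a (x a))%:E)) => [|x _]; last first.
  by rewrite atomE (independent_atom (q := fun a => q a (x a)) indep).
rewrite sumEFin lee_fin [leRHS]big_mkcond/= le_eqVlt; apply/orP; left.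
apply/eqP; apply: eq_bigr => x _; rewrite unfold_in.
by case: ifP => _; rewrite ?mul1r ?mul0r.
Qed.

End CountLaw.

(** * The approximation theorem *)

(** [s] and [t] are the product weights of an event and of its complement, whose
    true probabilities are [v] and [1 - v]; the last hypothesis says that little
    mass is missing. *)
Lemma subprobability_dist (R : realType) (m s t v e : R) :
  s <= v -> t <= 1 - v -> `|m - s| <= e -> `|1 - (s + t)| <= e ->
  `|m - v| <= 2 * e.
Proof.
rewrite !ler_norml => sv tv /andP[h1 h2] /andP[h3 h4].
by apply/andP; split; lra.
Qed.

Lemma probability_fine (R : realType) (dO : measure_display)
    (Omega : measurableType dO) (P : probability Omega R) (A : set Omega) :
  measurable A -> exists2 v : R, P A = v%:E & 0 <= v <= 1.
Proof.
move=> mA; have PA := fineK (fin_num_measure P _ mA).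
exists (fine (P A)); first by rewrite PA.
rewrite -!lee_fin [(fine _)%:E]PA; apply/andP; split; first exact: measure_ge0.
exact: probability_le1.
Qed.

Lemma dTV_le1 (R : realType) (dO dO' dT : measure_display)
    (Omega : measurableType dO) (Omega' : measurableType dO')
    (T : measurableType dT) (P : probability Omega R) (Q : probability Omega' R)
    (X : Omega -> T) (Y : Omega' -> T) :
  (forall A, measurable A -> measurable (X @^-1` A)) ->
  (forall A, measurable A -> measurable (Y @^-1` A)) ->
  (dTV (pushforward P X) (pushforward Q Y) <= 1)%E.
Proof.
move=> mX mY; apply: ge_ereal_sup => _ [A mA <-]; rewrite /pushforward.
have [u uE /andP[u0 u1]] := probability_fine P (mX A mA).
have [v vE /andP[v0 v1]] := probability_fine Q (mY A mA).
rewrite [P _]uE [Q _]vE -EFinB abse_EFin lee_fin ler_norml.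
by apply/andP; split; lra.
Qed.

Lemma measurable_joint (R : realType) (d n : nat) (dO : measure_display)
    (Omega : measurableType dO) (P : probability Omega R)
    (pi : 'I_d -> {RV P >-> {perm 'I_n}}) (S : set (perms d n)) :
  measurable (joint pi @^-1` S).
Proof.
have -> : joint pi @^-1` S = \bigcup_(g in S) [set w | forall l, pi l w = g l].
  apply/seteqP; split => w /=.
    by move=> Sw; exists (joint pi w) => //= l; rewrite ffunE.
  move=> [g Sg /= wg]; rewrite (_ : joint pi w = g)//.
  by apply/ffunP => l; rewrite ffunE.
by apply: fin_bigcup_measurable => // g _; exact: measurable_atom.
Qed.

Theorem theorem2p2 (R : realType) :
  exists c : R,
  forall (d n r : nat), (2 <= d)%N -> (1 <= n)%N -> (1 <= r)%N ->
  forall (dO : measure_display) (Omega : measurableType dO)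
    (P : probability Omega R) (pi : 'I_d -> {RV P >-> {perm 'I_n}}),
    (forall l : 'I_d, uniform_perm (pi l)) ->
    mutually_independent pi ->
  forall (dO' : measure_display) (Omega' : measurableType dO')
    (Q : probability Omega' R) (Z : cycle_upto d n r -> {RV Q >-> nat}),
    (forall alpha : cycle_upto d n r,
       poisson_rv ((n ^_ (cycle_length alpha))%:R^-1) (Z alpha)) ->
    mutually_independent Z ->
  (dTV (pushforward P (fun omega : Omega =>
          cycle_indicators r (fun l : 'I_d => pi l omega)))
       (pushforward Q (fun omega : Omega' =>
          [ffun alpha : cycle_upto d n r => Z alpha omega]))
   <= (c * (2 * d%:R - 1) ^+ (2 * r - 1) / n%:R)%:E)%E.
Proof.
exists 2080 => d n [//|r] d2 n1 _ dO Omega P pi unif indep dO' Omega' Q Z pois indepZ.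
have -> : (2 * r.+1 - 1 = (2 * r).+1)%N by lia.
have -> : (2 * d%:R - 1) ^+ (2 * r).+1 = ((2 * d - 1) ^ (2 * r).+1)%:R :> R.
  by rewrite natrX natrB ?natrM//; lia.
have indE w : cycle_indicators r.+1 (fun l => pi l w) =
    of_bits (contained_cycles r (joint pi w)).
  apply/ffunP => a; rewrite !ffunE; congr (nat_of_bool (contains _ _)).
  by apply/funext => l; rewrite ffunE.
have indA (A : set {ffun cycle_upto d n r.+1 -> nat}) :
    (fun w => cycle_indicators r.+1 (fun l => pi l w)) @^-1` A =
    [set w | of_bits (contained_cycles r (joint pi w)) \in A].
  by apply/seteqP; split => w /=; rewrite indE ?inE.
have N0 : 0 < n%:R :> R by rewrite ltr0n.
set b := ((2 * d - 1) ^ (2 * r).+1)%N.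
(* For small [n] the bound exceeds 1; for large [n] it gives [4 (r + 1) <= n]. *)
have [small|large] := ltnP n (2 * b).
  apply: (@le_trans _ _ 1%E).
    apply: dTV_le1 => A mA; last exact: measurable_joint_count mA.
    rewrite indA.
    exact: (measurable_joint pi [set g | of_bits (contained_cycles r g) \in A]).
  rewrite lee_fin ler_pdivlMr// mul1r -natrM ler_nat; lia.
have rn : (4 * r.+1 <= n)%N.
  apply: leq_trans large; rewrite (_ : 4 = 2 * 2)%N// -mulnA leq_mul2l /=.
  apply: (@leq_trans (3 ^ (2 * r).+1)); last by rewrite leq_exp2r//; lia.
  by have : ((2 * r).+1 < 3 ^ (2 * r).+1)%N by [exact: ltn_expl]; lia.
pose q (a : cycle_upto d n r.+1) (e : bool) := poisson_pmf (cyc_rate R a) e.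
have q0 a e : 0 <= q a e by exact: poisson_pmf_ge0.
have rate0 (a : cycle_upto d n r.+1) := rate_gt0 R d2 n1 rn a.
have q1 a : q a false + q a true <= 1 by exact: poisson_pmf01_le1.
have qt a : `|cyc_rate R a - q a true| <= cyc_rate R a ^+ 2 by exact: poisson_pmf1_dist.
have qf a : `|1 - cyc_rate R a - q a false| <= cyc_rate R a ^+ 2.
  exact: poisson_pmf0_dist.
have qZ a e : Q (Z a @^-1` [set nat_of_bool e]) = (q a e)%:E by exact: pois.
(* With [f] the indicator of [A] this compares the two laws on [A]; with [f = 1] it
   bounds the missing mass. *)
have approx := product_approx d2 n1 rn q0 q1 qt qf.
apply: ge_ereal_sup => _ [A mA <-]; rewrite /pushforward indA.
pose f (x : {ffun cycle_upto d n r.+1 -> bool}) : R := (of_bits x \in A)%:R.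
have muE := perm_law unif indep (fun g => of_bits (contained_cycles r g) \in A).
rewrite [P _]muE.
have mZA := measurable_joint_count Z mA.
have := count_law_ge indepZ qZ (measurableC mA).
rewrite preimage_setC probability_setC//.
have := count_law_ge indepZ qZ mA.
have [v vE _] := probability_fine Q mZA; rewrite vE.
rewrite -!EFinB !lee_fin => sA sC.
have fb x : `|f x| <= 1 by rewrite normr_nat lern1 leq_b1.
have HA := approx f fb.
have one_b (x : {ffun cycle_upto d n r.+1 -> bool}) : `|1 : R| <= 1 by rewrite normr1.
have H1 := approx (fun=> 1) one_b.
move: HA H1; rewrite mean_cst ?card_perms_gt0//.
rewrite [X in `|1 - X|](_ : _ = \sum_x (of_bits x \in A)%:R * \prod_a q a (x a) +
  \sum_x (of_bits x \in ~` A)%:R * \prod_a q a (x a)); last first.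
  rewrite -big_split/=; apply: eq_bigr => x _; rewrite -mulrDl; congr (_ * _).
  by rewrite in_setC; case: (_ \in _); rewrite /= ?addr0 ?add0r.
rewrite -[mean _]/(Pr R (fun g => of_bits (contained_cycles r g) \in A)).
move=> HA H1.
rewrite (_ : 2080 * b%:R / n%:R = 2 * (1040 * b%:R / n%:R) :> R); last first.
  by rewrite !mulrA -(natrM _ 2 1040).
exact: subprobability_dist sA sC HA H1.
Qed.
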